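(* Let $X\subset Y\subset Z$, where $X\subset Z$ is a regular closed embedding of smooth connected projective schemes and $Y$ is a closed subscheme of $Z$ with $Y_{\mathrm{red}}=X$. Let $Y_j$ be the members of the $S_1$-filtration of $Y$ and let $\mathcal{L}_j$ be the associated $\mathcal{O}_X$-modules. a) If $Y_j$ is Cohen-Macaulay and $\mathcal{L}_j$ is locally free on $X$, then $Y_{j+1}$ is Cohen-Macaulay. b) If $Y_j$ and $Y_{j+1}$ are Cohen-Macaulay, then $\mathcal{L}_j$ is locally free on $X$.
   Context: A scheme is Cohen-Macaulay if all its local rings are. Let $\mathcal{I}_X,\mathcal{I}_Y\subset\mathcal{O}_Z$ be the ideal sheaves and $X^{(i)}$ the subscheme of $Z$ with ideal sheaf $\mathcal{I}_X^{i+1}$. Let $k$ be the unique integer with $Y\subset X^{(k)}$ and $Y\not\subset X^{(k-1)}$. For $j\le k$, $Y_j$ is obtained from $Y\cap X^{(j)}$ by removing the embedded components (its ideal is the $I_X$-primary component of $I_Y+I_X^{j+1}$); the chain $X=Y_0\subset Y_1\subset\dots\subset Y_k\subset Y$ is the $S_1$-filtration of $Y$. Let $\mathcal{I}_j$ be the ideal sheaf of $Y_j$. One has $\mathcal{I}_X\mathcal{I}_j\subset\mathcal{I}_{j+1}\subset\mathcal{I}_j$, and $\mathcal{L}_j$ (for $0\le j<k$) is the $\mathcal{O}_X$-module defined by the exact sequence $0\to\mathcal{I}_{j+1}/\mathcal{I}_X\mathcal{I}_j\to\mathcal{I}_j/\mathcal{I}_X\mathcal{I}_j\to\mathcal{L}_j\to0$.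 *)

(* Defs.v *)
From HB Require Import structures.
From mathcomp Require Import all_boot all_order all_algebra.
From mathcomp Require Import generic_quotient ring_quotient fraction.
From mathcomp Require Import boolp.
From mathcomp Require Import mpoly.

Set Implicit Arguments.
Unset Strict Implicit.
Unset Printing Implicit Defensive.

Import GRing.Theory.
Local Open Scope ring_scope.
Local Open Scope quotient_scope.

(******************************************************************************)
(* Conventions.                                                               *)
(*                                                                            *)
(* A projective scheme over a field k is a closed subscheme of some P^n_k,    *)
(* i.e. Proj (S / I) with S = k[x_0, .., x_n] and I a homogeneous saturated   *)
(* ideal; I is determined by the subscheme, and W is contained in W' iff the  *)
(* ideal of W' is contained in the ideal of W.  A closed subscheme is         *)
(* represented by this ideal.                                                 *)
(*   The ideals of rings are Prop-valued and may be the unit ideal, hence     *)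
(* quotient rings are only comPzRingTypes.                                    *)
(******************************************************************************)

Section Submodule.
Variables (A : comPzRingType) (M : lmodType A).

Record submodule := Submodule {
  smem :> M -> Prop;
  smem0 : smem 0;
  smemD : forall x y, smem x -> smem y -> smem (x + y);
  smemZ : forall a x, smem x -> smem (a *: x) }.

Definition smem_pred (N : submodule) : {pred M} := fun x => `[< N x >].

Lemma smem_predP (N : submodule) x : reflect (N x) (x \in smem_pred N).
Proof. exact: asboolP. Qed.

Lemma smem_pred_closed (N : submodule) : submod_closed (smem_pred N).
Proof.
split=> [|a x y /smem_predP Nx /smem_predP Ny]; apply/smem_predP.
  exact: smem0.
by apply: smemD => //; apply: smemZ.
Qed.

HB.instance Definition _ (N : submodule) :=
  GRing.isSubmodClosed.Build A M (smem_pred N) (smem_pred_closed N).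

Section Span.
Variable P : M -> Prop.

Definition span_mem x := forall N : submodule, (forall y, P y -> N y) -> N x.

Fact span_mem0 : span_mem 0.
Proof. by move=> N _; apply: smem0. Qed.

Fact span_memD x y : span_mem x -> span_mem y -> span_mem (x + y).
Proof. by move=> Px Py N PN; apply: smemD; [apply: Px | apply: Py]. Qed.

Fact span_memZ a x : span_mem x -> span_mem (a *: x).
Proof. by move=> Px N PN; apply: smemZ; apply: Px. Qed.

Definition span := Submodule span_mem0 span_memD span_memZ.
End Span.

Record sub_mod (N : submodule) := SubMod {
  sub_val : M;
  sub_valP : sub_val \in smem_pred N }.

HB.instance Definition _ N := [isSub for @sub_val N].
HB.instance Definition _ N := [Choice of sub_mod N by <:].
HB.instance Definition _ N := [SubChoice_isSubLmodule of sub_mod N by <:].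

Section Quotient.
Variable N : submodule.

Definition quot_mod : Type := Quotient.quot (smem_pred N : zmodClosed M).

HB.instance Definition _ := GRing.Zmodule.on quot_mod.
HB.instance Definition _ :
  EqQuotient M (Quotient.equiv (smem_pred N : zmodClosed M)) quot_mod :=
  EqQuotient.on quot_mod.

Lemma quot_eqP (x y : M) : \pi_quot_mod x = \pi_quot_mod y <-> N (x - y).
Proof.
have e : (\pi_quot_mod x == \pi_quot_mod y) = ((x - y) \in smem_pred N).
  by rewrite -Quotient.idealrBE.
split=> [/eqP|/smem_predP]; first by rewrite e => /smem_predP.
by rewrite -e => /eqP.
Qed.

Lemma quot_piD (x y : M) :
  \pi_quot_mod x + \pi_quot_mod y = \pi_quot_mod (x + y).
Proof.
exact/esym/(@Quotient.pi_add M (smem_pred N : zmodClosed M) x y).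
Qed.

Lemma quot_pi0 : \pi_quot_mod 0 = 0.
Proof. by apply: (@addrI quot_mod (\pi_quot_mod 0)); rewrite quot_piD !addr0. Qed.

Definition quot_scale (a : A) (x : quot_mod) : quot_mod :=
  \pi_quot_mod (a *: repr x).

Lemma quot_piZ a (x : M) :
  quot_scale a (\pi_quot_mod x) = \pi_quot_mod (a *: x).
Proof.
apply/quot_eqP; rewrite -scalerBr; apply: smemZ.
by apply/quot_eqP; rewrite reprK.
Qed.

Fact quot_scaleA a b x : quot_scale a (quot_scale b x) = quot_scale (a * b) x.
Proof. by rewrite -[x]reprK !quot_piZ scalerA !reprK. Qed.

Fact quot_scale1 : left_id 1 quot_scale.
Proof. by move=> x; rewrite -[x]reprK quot_piZ scale1r. Qed.

Fact quot_scaleDr : right_distributive quot_scale +%R.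
Proof.
move=> a x y; rewrite -[x]reprK -[y]reprK.
by rewrite quot_piD !quot_piZ quot_piD scalerDr.
Qed.

Fact quot_scaleDl x : {morph quot_scale^~ x : a b / a + b}.
Proof. by move=> a b; rewrite -[x]reprK !quot_piZ quot_piD scalerDl. Qed.

HB.instance Definition _ := GRing.Zmodule_isLmodule.Build A quot_mod
  quot_scaleA quot_scale1 quot_scaleDr quot_scaleDl.
End Quotient.

End Submodule.

Notation ideal A := (submodule (A^o)).

Section RingQuotient.
Variables (A : comPzRingType) (I : ideal A).

Definition quot_ring : Type := quot_mod I.

HB.instance Definition _ := GRing.Zmodule.on quot_ring.
HB.instance Definition _ :
  EqQuotient A^o (Quotient.equiv (smem_pred I : zmodClosed A^o)) quot_ring :=
  EqQuotient.on quot_ring.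

Definition to_quot (x : A) : quot_ring := \pi_quot_ring (x : A^o).

Lemma to_quotP x : exists y, x = to_quot y.
Proof. by exists (repr x); rewrite /to_quot reprK. Qed.

Lemma to_quot_eqP x y : to_quot x = to_quot y <-> I (x - y).
Proof. exact: quot_eqP. Qed.

Lemma to_quotD x y : to_quot (x + y) = to_quot x + to_quot y.
Proof. exact/esym/quot_piD. Qed.

Definition quot_mul (x y : quot_ring) : quot_ring :=
  to_quot ((repr x : A) * (repr y : A)).

Lemma to_quotM x y : to_quot (x * y) = quot_mul (to_quot x) (to_quot y).
Proof.
have h z : I (z - (repr (to_quot z) : A)) by apply/quot_eqP; rewrite reprK.
apply/to_quot_eqP; set x' := repr _; set y' := repr _.
have -> : x * y - (x' : A) * y' = y * (x - x') + (x' : A) * (y - y').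
  by rewrite !mulrBr [y * x']mulrC [y * x]mulrC addrA subrK.
by apply: smemD; apply: smemZ; apply: h.
Qed.

Fact quot_mulA : associative quot_mul.
Proof.
move=> x y z; case: (to_quotP x) (to_quotP y) (to_quotP z)=> a -> [b ->] [c ->].
by rewrite -!to_quotM mulrA.
Qed.

Fact quot_mulC : commutative quot_mul.
Proof.
move=> x y; case: (to_quotP x) (to_quotP y) => a -> [b ->].
by rewrite -!to_quotM mulrC.
Qed.

Fact quot_mul1 : left_id (to_quot 1) quot_mul.
Proof. by move=> x; case: (to_quotP x) => a ->; rewrite -to_quotM mul1r. Qed.

Fact quot_mulDl : left_distributive quot_mul +%R.
Proof.
move=> x y z; case: (to_quotP x) (to_quotP y) (to_quotP z)=> a -> [b ->] [c ->].
by rewrite -to_quotD -!to_quotM mulrDl to_quotD.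
Qed.

HB.instance Definition _ := GRing.Zmodule_isComPzRing.Build quot_ring
  quot_mulA quot_mulC quot_mul1 quot_mulDl.

Lemma to_quotMr x y : to_quot (x * y) = to_quot x * to_quot y.
Proof. exact: to_quotM. Qed.

Definition quot_ideal_mem (J : ideal A) (y : (quot_ring^o)) : Prop :=
  exists2 x, J x & y = to_quot x.

Section QuotIdeal.
Variable J : ideal A.

Fact quot_ideal0 : quot_ideal_mem J 0.
Proof. by exists 0; [exact: smem0 | apply/esym/quot_pi0]. Qed.

Fact quot_idealD x y :
  quot_ideal_mem J x -> quot_ideal_mem J y -> quot_ideal_mem J (x + y).
Proof.
move=> [a Ja ->] [b Jb ->]; exists (a + b); first exact: smemD.
by rewrite to_quotD.
Qed.

Fact quot_idealZ c x : quot_ideal_mem J x -> quot_ideal_mem J (c *: x).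
Proof.
move=> [a Ja ->]; have [d ->] := to_quotP c; exists (d * a); first exact: smemZ.
by rewrite to_quotM.
Qed.

(* (J + I) / I *)
Definition quot_ideal : ideal quot_ring :=
  Submodule quot_ideal0 quot_idealD quot_idealZ.
End QuotIdeal.

End RingQuotient.

Definition smul (A : comPzRingType) (I : ideal A) (M : lmodType A) :
    submodule M :=
  span (fun x : M => exists (a : A) (m : M), I a /\ x = a *: m).

(* M / IM, as a module over A / I *)
Section ModIdeal.
Variables (A : comPzRingType) (I : ideal A) (M : lmodType A).

Definition mod_ideal : Type := quot_mod (smul I M).

HB.instance Definition _ := GRing.Zmodule.on mod_ideal.

Definition to_mod (x : M) : mod_ideal := \pi_(quot_mod (smul I M)) x.

Lemma to_modP x : exists y, x = to_mod y.
Proof. by exists (repr (x : quot_mod _)); rewrite /to_mod reprK. Qed.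

Lemma to_mod_eqP x y : to_mod x = to_mod y <-> smul I M (x - y).
Proof. exact: quot_eqP. Qed.

Lemma to_modD x y : to_mod (x + y) = to_mod x + to_mod y.
Proof. exact/esym/quot_piD. Qed.

Definition mod_scale (a : quot_ring I) (x : mod_ideal) : mod_ideal :=
  to_mod ((repr a : A) *: repr (x : quot_mod _)).

Lemma to_modZ a x : mod_scale (to_quot I a) (to_mod x) = to_mod (a *: x).
Proof.
apply/to_mod_eqP; set a' := repr _; set x' := repr _.
have -> : (a' : A) *: x' - a *: x = (a' - a) *: x' + a *: (x' - x).
  by rewrite scalerBl scalerBr addrA subrK.
apply: smemD; last by apply: smemZ; apply/to_mod_eqP; rewrite /to_mod reprK.
move=> N; apply; exists (a' - a), x'; split=> //.
by apply/to_quot_eqP; rewrite /to_quot reprK.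
Qed.

Fact mod_scaleA a b x : mod_scale a (mod_scale b x) = mod_scale (a * b) x.
Proof.
have [[[c ->] [d ->]] [y ->]] := (to_quotP a, to_quotP b, to_modP x).
by rewrite -to_quotMr !to_modZ scalerA.
Qed.

Fact mod_scale1 : left_id 1 mod_scale.
Proof. by move=> x; have [y ->] := to_modP x; rewrite to_modZ scale1r. Qed.

Fact mod_scaleDr : right_distributive mod_scale +%R.
Proof.
move=> a x y; have [[[c ->] [z ->]] [t ->]] := (to_quotP a, to_modP x, to_modP y).
by rewrite -to_modD !to_modZ scalerDr to_modD.
Qed.

Fact mod_scaleDl x : {morph mod_scale^~ x : a b / a + b}.
Proof.
move=> a b; have [[[c ->] [d ->]] [y ->]] := (to_quotP a, to_quotP b, to_modP x).
by rewrite -to_quotD !to_modZ scalerDl to_modD.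
Qed.

HB.instance Definition _ := GRing.Zmodule_isLmodule.Build (quot_ring I) mod_ideal
  mod_scaleA mod_scale1 mod_scaleDr mod_scaleDl.

Section Image.
Variable N : submodule M.

Definition mod_image_mem (y : mod_ideal) : Prop := exists2 x, N x & y = to_mod x.

Fact mod_image0 : mod_image_mem 0.
Proof.
by exists 0; [exact: smem0 | apply/esym/quot_pi0].
Qed.

Fact mod_imageD x y :
  mod_image_mem x -> mod_image_mem y -> mod_image_mem (x + y).
Proof.
move=> [a Na ->] [b Nb ->]; exists (a + b); first exact: smemD.
by rewrite to_modD.
Qed.

Fact mod_imageZ c x : mod_image_mem x -> mod_image_mem (c *: x).
Proof.
move=> [a Na ->]; have [d ->] := to_quotP c.
by exists (d *: a); [exact: smemZ | rewrite -to_modZ].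
Qed.

(* (N + IM) / IM *)
Definition mod_image : submodule mod_ideal :=
  Submodule mod_image0 mod_imageD mod_imageZ.
End Image.

End ModIdeal.

Section SubmoduleTrace.
Variables (A : comPzRingType) (M : lmodType A) (N N' : submodule M).

Definition trace_mem (x : sub_mod N) : Prop := N' (sub_val x).

Fact trace0 : trace_mem 0.
Proof. exact: smem0. Qed.
Fact traceD x y : trace_mem x -> trace_mem y -> trace_mem (x + y).
Proof. exact: smemD. Qed.
Fact traceZ a x : trace_mem x -> trace_mem (a *: x).
Proof. exact: smemZ. Qed.

(* N' :&: N, as a submodule of N *)
Definition trace : submodule (sub_mod N) := Submodule trace0 traceD traceZ.
End SubmoduleTrace.

Definition free (A : comPzRingType) (M : lmodType A) : Prop :=
  exists r (e : 'I_r -> M),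
    bijective (fun c : 'rV[A]_r => \sum_(i < r) c 0 i *: e i).

(******************************************************************************)
(*                       Commutative algebra                                  *)
(******************************************************************************)

Section Ideals.
Variable A : comPzRingType.
Implicit Types I J P Q : ideal A.

Definition sub_ideal I J : Prop := forall x, I x -> J x.
Definition proper I : Prop := ~ I 1.
Definition prime_ideal P : Prop :=
  proper P /\ forall x y : A, P (x * y) -> P x \/ P y.
Definition maximal_ideal P : Prop :=
  proper P /\ forall J, proper J -> sub_ideal P J -> sub_ideal J P.

Definition seq_ideal (s : seq A) : ideal A := span (fun x : A^o => x \in s).
Definition add_ideal I J : ideal A := span (fun x : A^o => I x \/ J x).
Definition mul_ideal I J : ideal A :=
  span (fun x : A^o => exists a b : A, [/\ I a, J b & x = a * b]).
Definition exp_ideal I m : ideal A :=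
  iter m (mul_ideal I) (span (fun _ : A^o => True)).

Definition in_radical I (x : A) : Prop := exists m, I (x ^+ m).

Definition primary_ideal Q : Prop :=
  proper Q /\ forall x y : A, Q (x * y) -> Q x \/ in_radical Q y.

(* J is the intersection of the Q i, irredundantly and with distinct radicals *)
Definition primary_decomposition J r (Q : 'I_r -> ideal A) : Prop :=
  [/\ forall i, primary_ideal (Q i),
      forall x, J x <-> forall i, Q i x,
      forall i, exists2 x, (forall j, j != i -> Q j x) & ~ Q i x
    & forall i j, (forall x, in_radical (Q i) x <-> in_radical (Q j) x) ->
        i = j].

Definition primary_component P J Q : Prop :=
  exists r (D : 'I_r -> ideal A), primary_decomposition J D /\
    exists i, (forall x, P x <-> in_radical (D i) x) /\
              (forall x, Q x <-> D i x).

Definition noetherian : Prop :=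
  forall I, exists s : seq A, forall x, I x <-> seq_ideal s x.

Definition prime_chain d : Prop :=
  exists c : nat -> ideal A,
    (forall i, (i <= d)%N -> prime_ideal (c i)) /\
    (forall i, (i < d)%N ->
       sub_ideal (c i) (c i.+1) /\ ~ sub_ideal (c i.+1) (c i)).

Definition krull_dim d : Prop :=
  prime_chain d /\ forall e, prime_chain e -> (e <= d)%N.

Definition regular_sequence (s : seq A) : Prop :=
  (forall i, (i < size s)%N -> forall x : A,
     seq_ideal (take i s) (s`_i * x) -> seq_ideal (take i s) x) /\
  proper (seq_ideal s).

Definition regular_sequence_in I d : Prop :=
  exists s : seq A,
    [/\ size s = d, forall x, x \in s -> I x & regular_sequence s].

Definition depth I d : Prop :=
  regular_sequence_in I d /\
  forall e, regular_sequence_in I e -> (e <= d)%N.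

Definition noetherian_local (m : ideal A) : Prop :=
  [/\ noetherian, maximal_ideal m
    & forall m', maximal_ideal m' -> forall x, m' x <-> m x].

Definition cohen_macaulay_ring : Prop :=
  exists m d, [/\ noetherian_local m, krull_dim d & depth m d].

Definition regular_local_ring : Prop :=
  exists m d, [/\ noetherian_local m, krull_dim d
    & exists s : seq A, size s = d /\ forall x, m x <-> seq_ideal s x].

End Ideals.

(******************************************************************************)
(*                       Projective schemes                                   *)
(******************************************************************************)

Section Proj.
Variables (k : fieldType) (n : nat).
Local Notation S := {mpoly k[n.+1]}.
Implicit Types I J W X Y Z : ideal S.

Definition homogeneous I : Prop := forall f d, I f -> I (pihomog mdeg d f).

Section Saturation.
Variable J : ideal S.

Definition sat_mem (f : S^o) : Prop :=
  exists N, forall d (g : S), (N <= d)%N -> g \is d.-homog -> J (g * (f : S)).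

Fact sat0 : sat_mem 0.
Proof. by exists 0%N => d g _ _; rewrite mulr0; apply: smem0. Qed.

Fact satD x y : sat_mem x -> sat_mem y -> sat_mem (x + y).
Proof.
move=> [N Jx] [N' Jy]; exists (maxn N N') => d g; rewrite geq_max.
case/andP=> le le' hg; rewrite mulrDr; apply: smemD; first exact: Jx hg.
exact: Jy hg.
Qed.

Fact satZ a x : sat_mem x -> sat_mem (a *: x).
Proof.
move=> [N Jx]; exists N => d g le hg; rewrite mulrCA.
by apply: smemZ; apply: Jx hg.
Qed.

(* For J homogeneous, the largest homogeneous ideal that defines the same
   subscheme as J. *)
Definition saturation : ideal S := Submodule sat0 satD satZ.
End Saturation.

Definition closed_subscheme W : Prop :=
  homogeneous W /\ sub_ideal (saturation W) W.

(* the scheme W is contained in the scheme W' *)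
Definition subscheme W W' : Prop := sub_ideal W' W.

Record point := Point {
  point_ideal :> ideal S;
  point_prime : prime_ideal point_ideal;
  point_homog : homogeneous point_ideal;
  point_relevant : exists i, ~ point_ideal 'X_i }.

Definition on_scheme W (p : point) : Prop := sub_ideal W p.

(* As the closed subsets of Proj S are the sets of points of homogeneous      *)
(* ideals, this is connectedness for the Zariski topology.                    *)
Definition connected W : Prop :=
  (exists p, on_scheme W p) /\
  forall V V', homogeneous V -> homogeneous V' ->
    (forall p, on_scheme W p -> on_scheme V p \/ on_scheme V' p) ->
    (forall p, on_scheme W p -> ~ (on_scheme V p /\ on_scheme V' p)) ->
    (forall p, on_scheme W p -> on_scheme V p) \/
    (forall p, on_scheme W p -> on_scheme V' p).

(* Y_red = X *)
Definition reduction Y X : Prop := forall f, X f <-> in_radical Y f.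

(* Homogeneous localization.  The multiplicative sets are the complement of   *)
(* a point p, giving the stalk at p, and the powers of a homogeneous f of     *)
(* positive degree, giving the sections over the affine open set D_+(f).      *)
Record mulset := Mulset {
  mulset_mem :> S -> Prop;
  mulset1 : mulset_mem 1;
  mulsetM : forall s t, mulset_mem s -> mulset_mem t -> mulset_mem (s * t) }.

Section Complement.
Variable p : point.

Fact compl1 : ~ p 1. Proof. by case: (point_prime p). Qed.

Fact complM (s t : S) : ~ p s -> ~ p t -> ~ p (s * t).
Proof. by move=> ps pt; case: (point_prime p) => _ h /h[]. Qed.

Definition complement := Mulset compl1 complM.
End Complement.

Section Powers.
Variable f : S.

Fact pow1 : exists m, 1 = f ^+ m. Proof. by exists 0%N. Qed.

Fact powM (s t : S) :
  (exists m, s = f ^+ m) -> (exists m, t = f ^+ m) -> exists m, s * t = f ^+ m.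
Proof. by move=> [a ->] [b ->]; exists (a + b)%N; rewrite exprD. Qed.

Definition powers := @Mulset (fun s => exists m, s = f ^+ m) pow1 powM.
End Powers.

Definition hfrac (T : mulset) (J : S -> Prop) (x : {fraction S}) : Prop :=
  exists d (a t : S), [/\ J a, a \is d.-homog, t \is d.-homog, T t /\ t != 0
    & x = tofrac a / tofrac t].

Section HomogeneousLocalization.
Variable T : mulset.

Lemma hfrac0 I : hfrac T I 0.
Proof.
exists 0%N, 0, 1; split; rewrite ?dhomog0 ?dhomog1 ?oner_eq0 ?tofrac0 ?mul0r //.
  exact: smem0.
by split=> //; apply: mulset1.
Qed.

Lemma hfracD I x y : hfrac T I x -> hfrac T I y -> hfrac T I (x + y).
Proof.
move=> [d [a [t [Ia ha ht [Tt t0] ->]]]] [e [b [u [Ib hb hu [Tu u0] ->]]]].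
exists (d + e)%N, (u * a + t * b), (t * u); split.
- by apply: smemD; apply: smemZ.
- by apply: rpredD; [rewrite addnC|]; apply: dhomogM.
- exact: dhomogM.
- by rewrite mulf_neq0 //; split=> //; apply: mulsetM.
- rewrite tofracD !tofracM addf_div ?tofrac_eq0 //.
  by rewrite [tofrac u * _]mulrC [tofrac t * tofrac b]mulrC.
Qed.

Lemma hfracM I x y :
  hfrac T (fun=> True) x -> hfrac T I y -> hfrac T I (x * y).
Proof.
move=> [d [a [t [_ ha ht [Tt t0] ->]]]] [e [b [u [Ib hb hu [Tu u0] ->]]]].
exists (d + e)%N, (a * b), (t * u); split.
- exact: smemZ.
- exact: dhomogM.
- exact: dhomogM.
- by rewrite mulf_neq0 //; split=> //; apply: mulsetM.
- by rewrite !tofracM mulf_div.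
Qed.

Definition hloc_pred : {pred {fraction S}} :=
  fun x => `[< hfrac T (fun=> True) x >].

Fact hloc_closed : subring_closed hloc_pred.
Proof.
pose I : ideal S := @Submodule _ _ (fun=> True) Logic.I (fun _ _ _ _ => Logic.I)
  (fun _ _ _ => Logic.I).
have h1 c : hfrac T (fun=> True) (tofrac c%:MP).
  exists 0%N, c%:MP, 1; split; rewrite ?dhomog1 ?oner_eq0 ?tofrac1 ?divr1 //.
    by rewrite -[_%:MP]mulr1 mul_mpolyC rpredZ ?dhomog1.
  by split=> //; apply: mulset1.
split=> [|x y /asboolP hx /asboolP hy|x y /asboolP hx /asboolP hy].
- by apply/asboolP; move: (h1 1); rewrite mpolyC1 tofrac1.
- apply/asboolP/(@hfracD I) => //; rewrite -mulN1r; apply: (@hfracM I) => //.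
  by move: (h1 (-1)); rewrite mpolyCN mpolyC1 tofracN tofrac1.
- by apply/asboolP/(@hfracM I).
Qed.

HB.instance Definition _ :=
  GRing.isSubringClosed.Build {fraction S} hloc_pred hloc_closed.

Record hloc := Hloc {
  hloc_val : {fraction S};
  hloc_valP : hloc_val \in hloc_pred }.

HB.instance Definition _ := [isSub for hloc_val].
HB.instance Definition _ := [Choice of hloc by <:].
HB.instance Definition _ := [SubChoice_isSubComNzRing of hloc by <:].

Definition loc_mem I (x : hloc^o) : Prop := hfrac T I (hloc_val x).

Fact loc0 I : loc_mem I 0. Proof. exact: hfrac0. Qed.
Fact locD I x y : loc_mem I x -> loc_mem I y -> loc_mem I (x + y).
Proof. exact: hfracD. Qed.
Fact locZ I a x : loc_mem I x -> loc_mem I (a *: x).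
Proof. by apply: hfracM; apply/asboolP/(hloc_valP a). Qed.

Definition loc_ideal I : ideal hloc := Submodule (@loc0 I) (@locD I) (@locZ I).

(* structure sheaf of the scheme W *)
Definition OO W : comPzRingType := quot_ring (loc_ideal W).

(* ideal sheaf, in the structure sheaf of Z, of the subscheme W of Z *)
Definition ideal_sheaf Z W : ideal (OO Z) :=
  quot_ideal (loc_ideal Z) (loc_ideal W).

End HomogeneousLocalization.

Definition cohen_macaulay W : Prop :=
  forall p, on_scheme W p -> cohen_macaulay_ring (OO (complement p) W).

Definition affine_nbhd (p : point) (f : S) : Prop :=
  ~ p f /\ exists2 d, (0 < d)%N & f \is d.-homog.

Definition regular_embedding X Z : Prop :=
  subscheme X Z /\
  forall p, on_scheme X p -> exists2 f, affine_nbhd p f &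
    exists s : seq (OO (powers f) Z),
      regular_sequence s /\
      forall x, ideal_sheaf (powers f) Z X x <-> seq_ideal s x.

(* The subscheme of Z with ideal sheaf I_X^i. *)
Definition power_subscheme Z X i : ideal S :=
  saturation (add_ideal Z (exp_ideal X i)).

(* X^(i) *)
Definition infinitesimal_nbhd Z X i : ideal S := power_subscheme Z X i.+1.

Definition meet_scheme W W' : ideal S := saturation (add_ideal W W').

(* X^(m) contains Y but X^(m - 1) does not, where X^(-1) is empty. *)
Definition S1_length Z X Y m : Prop :=
  subscheme Y (infinitesimal_nbhd Z X m) /\
  ~ subscheme Y (power_subscheme Z X m).

Definition S1_filtration Z X Y m (F : nat -> ideal S) : Prop :=
  forall j, (j <= m)%N ->
    primary_component X (meet_scheme Y (infinitesimal_nbhd Z X j)) (F j).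

Section LSheaf.
Variables (Z X : ideal S) (J J' : ideal S) (T : mulset).
Local Notation IX := (ideal_sheaf T Z X).
Local Notation IJ := (ideal_sheaf T Z J).
Local Notation IJ' := (ideal_sheaf T Z J').

(* The quotient of J / IX J by the image of J', as a module over O_Z / IX.    *)
(* Taking quotients commutes with taking sections over D_+(f), since this     *)
(* open set is affine and the sheaves are quasi-coherent.                     *)
Definition Lsheaf : lmodType (quot_ring IX) :=
  quot_mod (mod_image IX (trace IJ IJ')).
End LSheaf.

Definition locally_free_Lsheaf Z X J J' : Prop :=
  forall p, on_scheme X p ->
    exists2 f, affine_nbhd p f & free (Lsheaf Z X J J' (powers f)).

End Proj.

Definition base_change (k K : fieldType) (h : {rmorphism k -> K}) n
    (W : ideal {mpoly k[n.+1]}) : ideal {mpoly K[n.+1]} :=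
  span (fun g : {mpoly K[n.+1]}^o => exists2 f, W f & g = map_mpoly h f).

(* Smoothness over k as geometric regularity: after every extension of the   *)
(* base field, all local rings are regular.                                   *)
Definition smooth (k : fieldType) n (W : ideal {mpoly k[n.+1]}) : Prop :=
  forall (K : fieldType) (h : {rmorphism k -> K}) (p : point K n),
    on_scheme (base_change h W) p ->
    regular_local_ring (OO (complement p) (base_change h W)).

(* Main.v *)
Require Import Defs.
From mathcomp Require Import all_boot all_order all_algebra mpoly.
From mathcomp Require Import generic_quotient fraction boolp classical_sets ring.
(* Again, since vector.v shadows span and free. *)
Require Import Defs.

(** Let R be the homogeneous localization of the polynomial ring at a point p of
    X, and I, J, J' the ideals of X, Y_j, Y_(j+1) in R; then J' <= J <= I,
    I J <= J', I is nil modulo J', and the stalk of L_j is J / J'.  The rings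
    R / I, R / J, R / J' have the same dimension d, and since R / I is regular
    there are x_1, .., x_d with (x) + I = m.  If R / J is Cohen-Macaulay, then x
    is a regular sequence on R / J, because Koszul homology detects depth;
    likewise for R / J'.  So under b) x is regular on the kernel J / J' of
    R / J' -> R / J, and a finitely generated module over R / I on which
    generators of the maximal ideal form a regular sequence is free.
    Conversely, x regular on R / J forces x to be regular on R / I, as I is nil
    modulo J, hence on a free module J / J', hence on the extension R / J' of
    R / J by J / J'.  Freeness of the stalks spreads out to an open set D_+(f)
    because X is integral and J is finitely generated. *)

Set Implicit Arguments.
Unset Strict Implicit.
Unset Printing Implicit Defensive.

Import GRing.Theory.
Local Open Scope ring_scope.
Local Open Scope quotient_scope.

(** * Submodules and Nakayama's lemma *)

(** Cohen-Macaulayness only provides some regular sequence of length d, possibly a different one for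
    R / J and for R / J', whereas the exact sequence needs one and the same sequence on both. Koszul
    homology bridges this gap: its vanishing in degree 1 follows from the existence of any regular
    sequence as long as x and implies that x itself is regular. The lengths match because I, J and
    J' lie below the same primes, so that the three quotients have the same dimension. Regular
    sequences are studied inside the single ring R: [regseq J N s] treats the subquotient J / N by
    membership in ideals of R, so that R / J', R / J and J / J' can be compared without maps between
    quotients. On the geometric side, X is a minimal prime of Y + X^(j+1), hence f lies in the ideal
    of Y_j iff g f lies in Y + X^(j+1) for some g outside X. This makes the inclusions between the
    ideals a computation with the multiplier g. Sections over D_+(f) and stalks both lie in the
    fraction field of S, so the same basis serves for both. *)

Section Submodules.
Variables (R : comPzRingType) (M : lmodType R).
Implicit Types (N : submodule M) (x y : M).

Lemma smemN N x : N x -> N (- x).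
Proof. by rewrite -scaleN1r; apply: smemZ. Qed.

Lemma smemB N x y : N x -> N y -> N (x - y).
Proof. by move=> Nx /smemN; apply: smemD. Qed.

Lemma smem_sub N x y : N (x - y) -> N y -> N x.
Proof. by move=> Nxy Ny; rewrite -(subrK y x); apply: smemD. Qed.

Lemma smem_sum N (J : Type) (r : seq J) (P : pred J) (F : J -> M) :
  (forall i, P i -> N (F i)) -> N (\sum_(i <- r | P i) F i).
Proof. by move=> NF; elim/big_ind: _ => //; [apply: smem0 | apply: smemD]. Qed.

Lemma span_incl (P : M -> Prop) x : P x -> span P x.
Proof. by move=> Px N; apply. Qed.

Lemma submodule_ext N N' : (forall x, N x <-> N' x) -> N = N'.
Proof.
case: N N' => [P P0 PD PZ] [Q Q0 QD QZ] /= PQ.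
have ePQ : P = Q by apply/funext => x; apply/propext.
by subst Q; congr Submodule; apply: Prop_irrelevance.
Qed.

Definition spans (s : seq M) : submodule M := span (fun x => x \in s).

Lemma spans_subset (s t : seq M) x : {subset s <= t} -> spans s x -> spans t x.
Proof. by move=> st; apply=> y /st; apply: span_incl. Qed.

Lemma spans_nil x : spans [::] x -> x = 0.
Proof.
have D0 (y z : M) : y = 0 -> z = 0 -> y + z = 0 by move=> -> ->; rewrite addr0.
have Z0 a (y : M) : y = 0 -> a *: y = 0 by move=> ->; rewrite scaler0.
move/(_ (@Submodule _ _ (fun y => y = 0) (erefl _) D0 Z0)); apply=> y.
by rewrite in_nil.
Qed.

Lemma spans_cons a s x :
  spans (a :: s) x <-> exists c y, spans s y /\ x = c *: a + y.
Proof.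
split=> [|[c [y [sy ->]]]]; last first.
  apply: smemD; first by apply/smemZ/span_incl; rewrite mem_head.
  by apply: spans_subset sy => z; rewrite in_cons orbC => ->.
pose Q z := exists c y, spans s y /\ z = c *: a + y.
have Q0 : Q 0 by exists 0, 0; rewrite scale0r addr0; split=> //; apply: smem0.
have QD y z : Q y -> Q z -> Q (y + z).
  move=> [c [y' [sy ->]]] [d [z' [sz ->]]]; exists (c + d), (y' + z').
  by split; [apply: smemD | rewrite scalerDl addrACA].
have QZ b y : Q y -> Q (b *: y).
  move=> [c [y' [sy ->]]]; exists (b * c), (b *: y').
  by split; [apply: smemZ | rewrite scalerDr scalerA].
move/(_ (Submodule Q0 QD QZ)); apply=> y; rewrite in_cons => /orP[/eqP->|sy].
  by exists 1, 0; rewrite scale1r addr0; split=> //; apply: smem0.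
by exists 0, y; rewrite scale0r add0r; split=> //; apply: span_incl.
Qed.

Definition addS N N' : submodule M := span (fun x => N x \/ N' x).

Lemma addSP N N' x : addS N N' x <-> exists2 y, N y & N' (x - y).
Proof.
split=> [|[y Ny N'y]]; last first.
  rewrite -(subrK y x) addrC.
  by apply: smemD; apply: span_incl; [left | right].
pose Q z := exists2 y, N y & N' (z - y).
have Q0 : Q 0 by exists 0; rewrite ?subr0; apply: smem0.
have QD y z : Q y -> Q z -> Q (y + z).
  move=> [y' Ny N'y] [z' Nz N'z]; exists (y' + z'); first exact: smemD.
  by rewrite opprD addrACA; apply: smemD.
have QZ b y : Q y -> Q (b *: y).
  move=> [y' Ny N'y]; exists (b *: y'); first exact: smemZ.
  by rewrite -scalerBr; apply: smemZ.
move/(_ (Submodule Q0 QD QZ)); apply=> y [Ny|N'y].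
  by exists y; rewrite ?subrr //; apply: smem0.
by exists 0; rewrite ?subr0 //; apply: smem0.
Qed.

Definition noetherian_mod : Prop :=
  forall N, exists s : seq M, forall x, N x <-> spans s x.

End Submodules.

Section NoetherianModules.
Variable R : comPzRingType.

Lemma noetherian_regular : noetherian R -> noetherian_mod R^o.
Proof. by move=> nR N; have [s] := nR N; exists s. Qed.

Lemma noetherian_surj (M M' : lmodType R) (f : M -> M') :
  linear f -> (forall y, exists x, f x = y) ->
  noetherian_mod M -> noetherian_mod M'.
Proof.
move=> fL f_surj nM N.
have fD x y : f (x + y) = f x + f y by have := fL 1 x y; rewrite !scale1r.
have f0 : f 0 = 0 by apply: (addrI (f 0)); rewrite -fD !addr0.
have fZ a x : f (a *: x) = a *: f x by have := fL a x 0; rewrite f0 !addr0.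
pose P := @Submodule _ M (fun x => N (f x)).
have P0 : N (f 0) by rewrite f0; apply: smem0.
have PD x y : N (f x) -> N (f y) -> N (f (x + y)).
  by move=> *; rewrite fD; apply: smemD.
have PZ a x : N (f x) -> N (f (a *: x)).
  by move=> *; rewrite fZ; apply: smemZ.
have [s sP] := nM (P P0 PD PZ); exists (map f s) => y; split=> [|sy].
  have [x <-] := f_surj y => /(sP x) /= sx.
  pose Q := @Submodule _ M (fun x => spans (map f s) (f x)).
  have Q0 : spans (map f s) (f 0) by rewrite f0; apply: smem0.
  have QD z t : spans (map f s) (f z) -> spans (map f s) (f t) ->
      spans (map f s) (f (z + t)).
    by move=> *; rewrite fD; apply: smemD.
  have QZ a z : spans (map f s) (f z) -> spans (map f s) (f (a *: z)).
    by move=> *; rewrite fZ; apply: smemZ.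
  by apply: (sx (Q Q0 QD QZ)) => z sz; apply/span_incl/map_f.
by apply: sy => _ /mapP[z sz ->]; apply/(sP z)/span_incl.
Qed.

Lemma noetherian_pair (M M' : lmodType R) :
  noetherian_mod M -> noetherian_mod M' ->
  noetherian_mod ((M * M')%type : lmodType R).
Proof.
move=> nM nM' N.
pose P1 := @Submodule _ M (fun x => exists y, N (x, y)).
have P10 : exists y, N (0 : M, y) by exists 0; apply: smem0.
have P1D x x' : (exists y, N (x, y)) -> (exists y, N (x', y)) ->
    exists y, N (x + x', y).
  by move=> [y Ny] [y' Ny']; exists (y + y'); apply: (smemD Ny Ny').
have P1Z a x : (exists y, N (x, y)) -> exists y, N (a *: x, y).
  by move=> [y Ny]; exists (a *: y); apply: (smemZ a Ny).
have [s1 s1P] := nM (P1 P10 P1D P1Z).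
pose P2 := @Submodule _ M' (fun y => N (0, y)).
have P20 : N (0, 0) by apply: smem0.
have P2D y y' : N (0, y) -> N (0, y') -> N (0, y + y').
  by move=> Ny Ny'; rewrite -(addr0 (0 : M)); apply: (smemD Ny Ny').
have P2Z a y : N (0, y) -> N (0, a *: y).
  by move=> Ny; rewrite -(scaler0 M a); apply: (smemZ a Ny).
have [s2 s2P] := nM' (P2 P20 P2D P2Z).
have : forall x, exists y, x \in s1 -> N (x, y).
  move=> x; have [xs|xs] := boolP (x \in s1); last by exists 0.
  by have [y Ny] := (s1P x).2 (span_incl xs); exists y.
move=> /choice [g gP].
(* Lifts to [N] of generators of its first projection, together with generators of its intersection
   with 0 x M'. *)
pose t := [seq (x, g x) | x <- s1] ++ [seq (0, y) | y <- s2].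
exists t => z; split; last first.
  apply=> y; rewrite mem_cat => /orP[/mapP[x xs ->]|/mapP[x xs ->]].
    exact: gP.
  by apply: (s2P x).2; apply: span_incl.
have lift2 y : spans s2 y -> spans t (0, y).
  have Q0 : spans t (0, 0 : M') by apply: smem0.
  have QD x x' : spans t (0, x) -> spans t (0, x') -> spans t (0, x + x').
    by move=> tx tx'; rewrite -(addr0 (0 : M)); apply: (smemD tx tx').
  have QZ a x : spans t (0, x) -> spans t (0, a *: x).
    by move=> tx; rewrite -(scaler0 M a); apply: (smemZ a tx).
  move/(_ (@Submodule _ M' (fun y => spans t (0, y)) Q0 QD QZ)); apply=> x xs.
  by apply: span_incl; rewrite mem_cat map_f ?orbT.
have lift1 x : spans s1 x -> exists y, spans t (x, y) /\ N (x, y).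
  have Q0 : exists y, spans t (0 : M, y) /\ N (0, y).
    by exists 0; split; apply: smem0.
  have QD u v : (exists y, spans t (u : M, y) /\ N (u, y)) ->
      (exists y, spans t (v : M, y) /\ N (v, y)) ->
      exists y, spans t (u + v, y) /\ N (u + v, y).
    move=> [y [ty Ny]] [y' [ty' Ny']]; exists (y + y').
    by split; [apply: (smemD ty ty') | apply: (smemD Ny Ny')].
  have QZ a u : (exists y, spans t (u : M, y) /\ N (u, y)) ->
      exists y, spans t (a *: u, y) /\ N (a *: u, y).
    move=> [y [ty Ny]]; exists (a *: y).
    by split; [apply: (smemZ a ty) | apply: (smemZ a Ny)].
  move/(_ (Submodule Q0 QD QZ)); apply=> u us; exists (g u); split; last exact: gP.
  by apply: span_incl; rewrite mem_cat (map_f (fun x => (x, g x))).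
case: z => x y Nxy; have [|y' [ty' Ny']] := lift1 x.
  by apply/s1P; exists y.
have -> : (x, y) = (x, y') + (0, y - y').
  by congr pair; rewrite /= ?addr0 // addrC subrK.
apply: (smemD ty'); apply: lift2; apply/(s2P _); rewrite /=.
have -> : (0, y - y') = (x, y) - (x, y') :> (M * M')%type.
  by congr pair; rewrite /= subrr.
exact: smemB.
Qed.

Lemma noetherian_rV r : noetherian R -> noetherian_mod ('rV[R]_r : lmodType R).
Proof.
move=> nR; elim: r => [|r IH].
  move=> N; exists [::] => x; split=> _; rewrite (thinmx0 x); exact: smem0.
pose f (z : (R^o * 'rV[R]_r)%type) : 'rV[R]_(1 + r) :=
  row_mx (\row_(_ < 1) z.1) z.2.
have fL : linear f.
  move=> a [x u] [y v]; rewrite /f /= scale_row_mx add_row_mx; congr row_mx.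
  by apply/rowP => i; rewrite !mxE.
apply: (noetherian_surj fL) => [v|].
  exists (v 0 0, rsubmx v); rewrite /= /f -[RHS](hsubmxK v) /=; congr row_mx.
  by apply/rowP => i; rewrite !mxE ord1; congr (v _ _); apply/val_inj.
by apply: noetherian_pair => //; apply: noetherian_regular.
Qed.

End NoetherianModules.


Section Nakayama.
Variables (R : comPzRingType) (M : lmodType R).

Lemma nakayama (a : R) (N B : submodule M) :
  (forall c, exists b, b * (1 - c * a) = 1) -> noetherian_mod M ->
  (forall x, N x -> exists2 y, N y & B (x - a *: y)) ->
  forall x, N x -> B x.
Proof.
move=> inva /(_ N) [s sP] NaN.
have sN x : x \in s -> N x by move=> xs; apply/sP/span_incl.
have : forall x, N x -> exists2 y, spans s y & B (x - y).
  by move=> x /sP sx; exists x; rewrite ?subrr //; apply: smem0.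
elim: s sN {sP} => [|g s IH] sN NsB.
  by move=> x /NsB[y /spans_nil ->]; rewrite subr0.
apply: IH => [x xs|x /NsB[_ /spans_cons[c [y [sy ->]]] Bx]].
  by apply: sN; rewrite in_cons xs orbT.
have [y' /NsB[_ /spans_cons[d [z [sz ->]]] Bz] Bg] := NaN g (sN g (mem_head _ _)).
have [b bP] := inva d; exists (c *: (b *: (a *: z)) + y).
  by apply: smemD => //; do 3!apply: smemZ.
rewrite -(subrK (c *: g + y) x) -addrA; apply: smemD => //.
rewrite opprD addrACA subrr addr0 -scalerBr; apply: smemZ.
have -> : g - b *: (a *: z) = b *: ((g - a *: y') + a *: (y' - (d *: g + z))).
  rewrite scalerBr addrA subrK [a *: (_ + z)]scalerDr opprD addrA.
  rewrite scalerBr; congr (_ - _).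
  by rewrite scalerA mulrC -{2}[g]scale1r -scalerBl scalerA bP scale1r.
by apply/smemZ/smemD => //; apply: smemZ.
Qed.

End Nakayama.

(** * Regular sequences *)

Section RegularSequences.
Variable R : comPzRingType.
Implicit Types (I J K N : ideal R) (a x z : R) (s : seq R).

Lemma idealM N a x : N x -> N (a * x).
Proof. exact: smemZ. Qed.

Lemma idealMr N a x : N x -> N (x * a).
Proof. by rewrite mulrC; apply: idealM. Qed.

Lemma ideal_sub N x z : N (x - z) -> N z -> N x.
Proof. exact: smem_sub. Qed.

(** The unit ideal: with [J = fullI] the subquotient J / N is the ring R / N. *)
Definition fullI : ideal R :=
  @Submodule _ R^o (fun=> True) Logic.I (fun _ _ _ _ => Logic.I)
    (fun _ _ _ => Logic.I).

Section AddMultiples.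
Variables (J N : ideal R) (a : R).

Definition addm_mem (z : R^o) : Prop := exists2 c : R, J c & N ((z : R) - a * c).

Fact addm0 : addm_mem 0.
Proof. by exists 0; rewrite ?mulr0 ?subr0; apply: smem0. Qed.

Fact addmD x y : addm_mem x -> addm_mem y -> addm_mem (x + y).
Proof.
move=> [c Jc Nc] [d Jd Nd]; exists (c + d); first exact: smemD.
by rewrite mulrDr opprD addrACA; apply: smemD.
Qed.

Fact addmZ b (x : R^o) : addm_mem x -> addm_mem (b *: x : R^o).
Proof.
move=> [c Jc Nc]; exists (b * c); first exact: idealM.
by rewrite mulrCA -mulrBr; apply: idealM.
Qed.

(* N + a J *)
Definition addm : ideal R := Submodule addm0 addmD addmZ.

End AddMultiples.

Lemma addm_sub J N a z : N z -> addm J N a z.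
Proof. by exists 0; rewrite ?mulr0 ?subr0 //; apply: smem0. Qed.

Lemma addm_mul J N a z : J z -> addm J N a (a * z).
Proof. by exists z; rewrite ?subrr //; apply: smem0. Qed.

Lemma addm_self N a : addm fullI N a a.
Proof. by exists 1; rewrite ?mulr1 ?subrr //; apply: smem0. Qed.

Lemma addm_mono J J' N N' a : sub_ideal J J' -> sub_ideal N N' ->
  sub_ideal (addm J N a) (addm J' N' a).
Proof. by move=> JJ' NN' z [c /JJ' J'c /NN' N'z]; exists c. Qed.

(* N + (s) J *)
Definition gens J N s : ideal R := foldl (addm J) N s.

Lemma gens_rcons J N s a : gens J N (rcons s a) = addm J (gens J N s) a.
Proof. by rewrite /gens -cats1 foldl_cat. Qed.

Lemma gens_mono J J' N N' s : sub_ideal J J' -> sub_ideal N N' ->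
  sub_ideal (gens J N s) (gens J' N' s).
Proof.
by move=> JJ'; elim: s N N' => [//|a s IH] N N' NN'; apply/IH/addm_mono.
Qed.

Lemma gens_sub J N s : sub_ideal N (gens J N s).
Proof. by elim: s N => [|a s IH] N z Nz //; apply/IH/addm_sub. Qed.

Lemma gens_mul J N s a z : a \in s -> J z -> gens J N s (a * z).
Proof.
elim: s N => [//|b s IH] N; rewrite in_cons => /orP[/eqP-> Jz|]; last exact: IH.
by apply: (@gens_sub J (addm J N b)); apply: addm_mul.
Qed.

Lemma gens_min J N K s : sub_ideal N K ->
  (forall a z, a \in s -> J z -> K (a * z)) -> sub_ideal (gens J N s) K.
Proof.
elim: s N => [//|a s IH] N NK sK; apply: IH => [z [c Jc /NK Kz]|b z bs Jz].
  by apply: smem_sub Kz _; apply: sK => //; apply: mem_head.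
by apply: sK => //; rewrite in_cons bs orbT.
Qed.

Lemma gens_fullP K s z :
  gens fullI K s z <-> exists2 c, seq_ideal s c & K (z - c).
Proof.
split=> [|[c sc Kz]].
  have : sub_ideal (gens fullI K s) (addS (seq_ideal s) K).
    apply: gens_min => [y Ky|a y sa _]; apply/addSP.
      by exists 0; rewrite ?subr0 //; apply: smem0.
    exists (a * y); rewrite ?subrr; last exact: smem0.
    by rewrite mulrC; apply/idealM/span_incl.
  by move=> sub /sub /addSP.
apply: smem_sub; first exact: gens_sub Kz.
apply: sc => y sy; rewrite -[y]mulr1; exact: gens_mul.
Qed.

Lemma gens_perm K s t : s =i t -> gens fullI K s = gens fullI K t.
Proof.
move=> st; apply: submodule_ext => z.
split; apply: gens_min => [y|a y sa _]; try exact: gens_sub.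
  by apply: gens_mul; rewrite -?st.
by apply: gens_mul; rewrite ?st.
Qed.

(* s is a (weakly) regular sequence on J / N *)
Fixpoint regseq J N s : Prop :=
  if s is a :: s' then
    (forall z, J z -> N (a * z) -> N z) /\ regseq J (addm J N a) s'
  else True.

Lemma regseq_rcons J N s a : regseq J N (rcons s a) <->
  regseq J N s /\ (forall z, J z -> gens J N s (a * z) -> gens J N s z).
Proof.
elim: s N => [|b s IH] N /=; first by split=> [[? _]|[_ ?]].
split=> [[Nb /IH[Ns Na]]|[[Nb Ns] Na]]; do ?split=> //.
by apply/IH; split.
Qed.

Lemma regseqP J N s : regseq J N s <-> forall i, (i < size s)%N ->
  forall z, J z -> gens J N (take i s) (s`_i * z) -> gens J N (take i s) z.
Proof.
elim: s N => [|a s IH] N /=; first by split.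
split=> [[Na /IH Ns] [|i] //= lt_is|Ns]; first exact: Ns.
split=> [|]; first exact: (Ns 0%N isT).
by apply/IH => i lt_is; apply: (Ns i.+1).
Qed.

End RegularSequences.

Arguments fullI {R}.

(** * Koszul complexes *)

Section Koszul.
Variable R : comPzRingType.
Implicit Types (K : ideal R) (a b x z : R) (s : seq R) (n p : nat).

(* An element of kos n.+1 is a pair (u, v) standing for u + e v in the
   exterior algebra, where e is the new generator. *)
Fixpoint kos n : lmodType R :=
  if n is n'.+1 then (kos n' * kos n')%type : lmodType R else R^o.

(** This is d(u + e v) = du + a v - e dv, the Leibniz rule with de = a. *)
Fixpoint kd s : kos (size s) -> kos (size s) :=
  match s with
  | [::] => fun=> 0
  | a :: s' => fun u => (kd u.1 + a *: u.2, - kd u.2)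
  end.

Fixpoint kdeg n p : kos n -> Prop :=
  match n with
  | 0 => fun u => p = 0%N \/ u = 0
  | n'.+1 => fun u =>
      kdeg p u.1 /\ (if p is p'.+1 then kdeg p' u.2 else u.2 = 0)
  end.

(** The Koszul complex of R / K is handled through chains over R up to [kin_mem K], so that K can
    grow in an induction while the complex stays the same. *)
Fixpoint kin_mem K n : kos n -> Prop :=
  match n with
  | 0 => K
  | n'.+1 => fun u => kin_mem K u.1 /\ kin_mem K u.2
  end.

Fixpoint kone n : R -> kos n :=
  match n with
  | 0 => fun a => a
  | n'.+1 => fun a => (kone n' a, 0)
  end.

Fact kin0 K n : kin_mem K (0 : kos n).
Proof. by elim: n => [|n IH] /=; [apply: smem0 | split]. Qed.

Fact kinD K n (u v : kos n) : kin_mem K u -> kin_mem K v -> kin_mem K (u + v).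
Proof.
elim: n u v => [|n IH] /= u v; first exact: smemD.
by move=> [u1 u2] [v1 v2]; split; apply: IH.
Qed.

Fact kinZ K n a (u : kos n) : kin_mem K u -> kin_mem K (a *: u).
Proof.
elim: n u => [|n IH] /= u; first exact: smemZ.
by move=> [u1 u2]; split; apply: IH.
Qed.

Definition kin K n : submodule (kos n) :=
  Submodule (@kin0 K n) (@kinD K n) (@kinZ K n).

Fact kdeg0 n p : kdeg p (0 : kos n).
Proof. by elim: n p => [|n IH] [|p] /=; try (by right); split. Qed.

Fact kdegD n p (u v : kos n) : kdeg p u -> kdeg p v -> kdeg p (u + v).
Proof.
elim: n p u v => [|n IH] p /= u v.
  by move=> [->|->]; rewrite ?add0r // => _; left.
move=> [u1 u2] [v1 v2]; split; first exact: IH.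
by case: p u1 u2 v1 v2 => [_ -> _ ->|p _ u2 _ v2]; rewrite ?addr0 //; apply: IH.
Qed.

Fact kdegZ n p a (u : kos n) : kdeg p u -> kdeg p (a *: u).
Proof.
elim: n p u => [|n IH] p /= u.
  by move=> [->|->]; [left | right; rewrite scaler0].
move=> [u1 u2]; split; first exact: IH.
by case: p u1 u2 => [_ ->|p _ u2]; rewrite ?scaler0 //; apply: IH.
Qed.

Definition kdeg_sub n p : submodule (kos n) :=
  Submodule (@kdeg0 n p) (@kdegD n p) (@kdegZ n p).

Lemma kdegN n p (u : kos n) : kdeg p u -> kdeg p (- u).
Proof. exact: (@smemN _ _ (kdeg_sub n p)). Qed.

Lemma kdeg_gt n p (u : kos n) : (n < p)%N -> kdeg p u -> u = 0.
Proof.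
elim: n p u => [|n IH] [|p] //= u; first by move=> _ [].
case: u => u v /= np [u0 v0].
by rewrite (IH _ _ np v0) (IH _ _ (ltnW np) u0).
Qed.

Lemma kd_linear s : linear (@kd s).
Proof.
elim: s => [|a s IH] b u v /=; first by rewrite scaler0 addr0.
congr pair; rewrite IH /=; last by rewrite opprD scalerN.
by rewrite !scalerDr !scalerA [a * b]mulrC addrACA.
Qed.

Lemma kdD s (u v : kos (size s)) : kd (u + v) = kd u + kd v.
Proof. by have := kd_linear 1 u v; rewrite !scale1r. Qed.

Lemma kd0 s : kd (0 : kos (size s)) = 0.
Proof. by apply: (addrI (kd 0)); rewrite -kdD !addr0. Qed.

Lemma kdZ s a (u : kos (size s)) : kd (a *: u) = a *: kd u.
Proof. by have := kd_linear a u 0; rewrite kd0 !addr0. Qed.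

Lemma kdN s (u : kos (size s)) : kd (- u) = - kd u.
Proof. by rewrite -scaleN1r kdZ scaleN1r. Qed.

Lemma kdK s (u : kos (size s)) : kd (kd u) = 0.
Proof.
elim: s u => [|a s IH] //= [u v] /=.
by congr pair; rewrite ?kdD ?kdN ?kdZ !IH ?oppr0 // add0r scalerN subrr.
Qed.

Lemma kd_kdeg0 s (u : kos (size s)) : kdeg 0 u -> kd u = 0.
Proof.
elim: s u => [|a s IH] //= [u v] /= [/IH-> ->].
by rewrite kd0 oppr0 scaler0 addr0.
Qed.

Lemma kd_kdeg s p (u : kos (size s)) : kdeg p.+1 u -> kdeg p (kd u).
Proof.
elim: s p u => [|a s IH] p /= u; first by right.
case: u => u v /= [hu hv]; split.
  by apply: kdegD; [apply: IH | apply: kdegZ].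
case: p hu hv => [|p] hu hv; first by rewrite kd_kdeg0 // oppr0.
by apply: kdegN; apply: IH.
Qed.

Lemma kd_kin K s (u : kos (size s)) : kin K _ u -> kin K _ (kd u).
Proof.
elim: s u => [|a s IH] /=; first by move=> u _; apply: (smem0 K).
move=> [u v] [/IH hu hv]; split; first by apply: kinD => //; apply: kinZ.
by apply: smemN (kin K _) _ _; apply: IH.
Qed.

Lemma kone_deg n a : kdeg 0 (kone n a).
Proof. by elim: n => [|n IH] /=; [left | split]. Qed.

Lemma kone_surj n (u : kos n) : kdeg 0 u -> exists a, u = kone n a.
Proof.
elim: n u => [|n IH] /= u; first by exists u.
by case: u => u v /= [/IH[a ->] ->]; exists a.
Qed.

Lemma koneZ n a b : a *: kone n b = kone n (a * b).
Proof. by elim: n => [|n IH] //=; congr pair => //=; rewrite scaler0. Qed.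

Lemma koneD n a b : kone n a + kone n b = kone n (a + b).
Proof. by elim: n => [|n IH] //=; congr pair => //=; rewrite addr0. Qed.

Lemma kin_kone K n a : kin K n (kone n a) <-> K a.
Proof.
elim: n => [|n IH] //=; split=> [[/IH]//|/IH ?]; split=> //; exact: kin0.
Qed.

Lemma kd_deg1 s (u : kos (size s)) : kdeg 1 u ->
  exists2 c, seq_ideal s c & kd u = kone _ c.
Proof.
elim: s u => [|a s IH] /=.
  by move=> u _; exists 0; [apply: (smem0 (seq_ideal [::])) |].
move=> [u v] /= [/IH[c sc ->] v0]; have [b vb] := kone_surj v0.
exists (c + a * b); last by rewrite kd_kdeg0 // oppr0 vb koneZ koneD.
apply: (smemD (s := seq_ideal (a :: s))).
  by apply: sc => y sy; apply: span_incl; rewrite in_cons sy orbT.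
by rewrite mulrC; apply: idealM; apply: span_incl; rewrite mem_head.
Qed.

(** A null-homotopy of multiplication by [c]; the last clause makes it descend to the complex modulo
    every K. *)
Definition khomotopy s c (h : kos (size s) -> kos (size s)) : Prop :=
  [/\ linear h, forall u, kd (h u) + h (kd u) = c *: u,
      forall p u, kdeg p u -> kdeg p.+1 (h u)
    & forall K u, kin K _ u -> kin K _ (h u)].

(* Contraction with the generators: (x) acts by zero on Koszul homology. *)
Lemma khomotopy_exists s c : seq_ideal s c ->
  exists h, @khomotopy s c h.
Proof.
pose P c := exists h, @khomotopy s c h.
have P0 : P 0.
  exists (fun=> 0); split=> [b u v|u|p u _|K u _].
  - by rewrite scaler0 addr0.
  - by rewrite kd0 addr0 scale0r.
  - exact: kdeg0.
  - exact: smem0.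
have PD b d : P b -> P d -> P (b + d).
  move=> [h [hl hc hd hk]] [g [gl gc gd gk]]; exists (fun u => h u + g u).
  split=> [e u v|u|p u pu|K u Ku].
  - by rewrite hl gl scalerDr addrACA.
  - by rewrite kdD addrACA hc gc scalerDl.
  - by apply: kdegD; [apply: hd | apply: gd].
  - by apply: smemD; [apply: hk | apply: gk].
have PZ b d : P d -> P (b *: (d : R^o)).
  move=> [h [hl hc hd hk]]; exists (fun u => b *: h u).
  split=> [e u v|u|p u pu|K u Ku].
  - by rewrite hl scalerDr !scalerA mulrC.
  - by rewrite kdZ -scalerDr hc scalerA.
  - by apply: kdegZ; apply: hd.
  - by apply: smemZ; apply: hk.
suff Ps x : x \in s -> P x.
  by move/(_ (@Submodule _ R^o P P0 PD PZ)); apply => x /Ps.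
move=> {P0 PD PZ}; rewrite {}/P; elim: s => [//|a s IH].
rewrite in_cons => /orP[/eqP->|/IH[h [hl hc hd hk]]].
  (* For the head [a] the homotopy is left multiplication by the new generator e. *)
  exists (fun u => (0, u.1)); split=> /= [e u v|u|p u [u1 u2]|K u [u1 u2]].
  - by congr pair; rewrite /= scaler0 addr0.
  - congr pair; rewrite /= ?kd0 ?addr0 ?add0r //.
    by rewrite addrA addNr add0r.
  - by split; [apply: kdeg0 | ].
  - by split; [apply: kin0 | ].
have h0 : h 0 = 0.
  have := hl (-1) 0 0; rewrite scaleN1r oppr0 addr0 => {1}->.
  by rewrite scaleN1r addNr.
have hD u v : h (u + v) = h u + h v by have := hl 1 u v; rewrite !scale1r.
have hZ b u : h (b *: u) = b *: h u.
  by have := hl b u 0; rewrite h0 !addr0.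
have hN u : h (- u) = - h u by rewrite -scaleN1r hZ scaleN1r.
(* [h] has degree one and therefore anticommutes with e, whence the sign. *)
exists (fun u => (h u.1, - h u.2)); split=> /= [e u v|u|p u [u1 u2]|K u [u1 u2]].
- by congr pair; rewrite /= hl // opprD scalerN.
- congr pair; rewrite /= ?kdN ?opprK ?hN ?opprK ?hc //.
  by rewrite hD hZ scalerN addrACA addNr addr0 hc.
- split; first exact: hd.
  by case: p u1 u2 => [_ ->|p _ u2]; [rewrite h0 oppr0; apply: kdeg0 |];
    apply: kdegN; apply: hd.
- by split; [apply: hk | apply: smemN (kin K _) _ _; apply: hk].
Qed.

(* H_p(s; R / K) = 0 *)
Definition kacyclic K s p : Prop := forall u : kos (size s), kdeg p u ->
  kin K _ (kd u) -> exists2 v, kdeg p.+1 v & kin K _ (u - kd v).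

Lemma kin_addm_deg K n p a (u : kos n) : kdeg p u -> kin (addm fullI K a) n u ->
  exists2 v, kdeg p v & kin K n (u - a *: v).
Proof.
elim: n p u => [|n IH] p /=.
  move=> u [->|->] [c _ Kc]; first by exists c; [left |].
  by exists 0; [right | rewrite scaler0 subr0; apply: smem0].
move=> [u v] /= [pu pv] [Ku Kv].
have [u' du' hu] := IH _ _ pu Ku; case: p pu du' pv => [|p] pu du' pv.
  exists (u', 0) => //=; split=> //=.
  by rewrite pv scaler0 subr0; apply: kin0.
have [v' dv' hv] := IH _ _ pv Kv.
by exists (u', v').
Qed.

Lemma kin_regular K n a (u : kos n) : (forall z, K (a * z) -> K z) ->
  kin K n (a *: u) -> kin K n u.
Proof.
by move=> Ka; elim: n u => [|n IH] /= u; [apply: Ka | move=> [/IH ? /IH ?]].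
Qed.

Lemma kin_ideal_scale K n a (u : kos n) : K a -> kin K n (a *: u).
Proof.
move=> Ka; elim: n u => [|n IH] /= u; last by split; apply: IH.
exact: (idealMr (u : R) Ka).
Qed.

Lemma kin_mono K K' n (u : kos n) : sub_ideal K K' -> kin K n u -> kin K' n u.
Proof.
by move=> KK'; elim: n u => [|n IH] /= u; [apply: KK' | move=> [/IH ? /IH ?]].
Qed.

(** Induction on [t], along the long exact sequence of multiplication by its head [a] on R / K:
    vanishing of H_(p+1) for K + (a) makes [a] injective on H_p for K. A power of [a] lies in (s) +
    K and so kills H_p, which must then be zero. *)
Theorem kacyclic_regular K s t :
  regseq fullI K t ->
  (forall a, a \in t -> exists N, gens fullI K s (a ^+ N)) ->
  forall p, (size s < p + size t)%N -> kacyclic K s p.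
Proof.
elim: t K => [|a t IH] K /=.
  move=> _ _ p; rewrite addn0 => sp u /(kdeg_gt sp)-> _.
  by exists 0; [apply: kdeg0 | rewrite kd0 subrr; apply: kin0].
move=> [Ka Kt] ts p; rewrite addnS => ps.
pose Ka' := addm fullI K a.
have KKa z : K z -> Ka' z by apply: addm_sub.
have Ka'a : Ka' a by apply: addm_self.
have acyc : kacyclic Ka' s p.+1.
  apply: IH => // b bt; have [|N bN] := ts b; first by rewrite in_cons bt orbT.
  by exists N; apply: gens_mono bN.
(* Injectivity of [a] on H_p. Modulo K + (a) the chain [v] is a cycle, hence v = dw + a w' modulo K
   for some w and w'; then a (u - dw') is zero modulo K, and [a] can be cancelled. *)
have div (u v : kos (size s)) : kdeg p u -> kdeg p.+1 v ->
    kin K _ (a *: u - kd v) -> exists2 w, kdeg p.+1 w & kin K _ (u - kd w).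
  move=> du dv Kuv.
  have [|w dw Kw] := acyc v dv.
    rewrite -(subKr (a *: u) (kd v)); apply: smemB (kin_mono KKa Kuv).
    exact: kin_ideal_scale.
  have dvw : kdeg p.+1 (v - kd w) by apply: kdegD => //; apply/kdegN/kd_kdeg.
  have [w' dw' Kw'] := kin_addm_deg dvw Kw.
  exists w' => //; apply: (kin_regular (a := a)) => [z|]; first exact: Ka.
  have -> : a *: (u - kd w') = (a *: u - kd v) + kd (v - kd w - a *: w').
    by rewrite !kdD !kdN kdK oppr0 addr0 kdZ addrA subrK scalerBr.
  by apply: smemD => //; apply: kd_kin.
(* Modulo K, a^N equals some c in (s), and the homotopy for c exhibits a^N u as the boundary of
   [h u]. The factors [a] are then removed one at a time by [div]. *)
have [N /gens_fullP[c /khomotopy_exists[h [hl hc hd hk]] Kc]] :=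
  ts a (mem_head _ _).
move=> u du Ku.
have : exists2 v, kdeg p.+1 v & kin K _ (a ^+ N *: u - kd v).
  exists (h u); first exact: hd.
  have -> : a ^+ N *: u - kd (h u) = (a ^+ N - c) *: u + h (kd u).
    by rewrite scalerBl -hc opprD -addrA -addrA addNr addr0.
  by apply: smemD; [apply: kin_ideal_scale | apply: hk].
elim: N {Kc} => [|N IHN]; first by rewrite scale1r.
move=> [v dv Kv]; apply: IHN; apply: (div _ v) => //; first exact: kdegZ.
by rewrite scalerA -exprS.
Qed.

Hypothesis nR : noetherian R.

Lemma noetherian_kos n : noetherian_mod (kos n).
Proof.
elim: n => [|n IH] /=; first exact: noetherian_regular.
exact: noetherian_pair.
Qed.

(* A 1-cycle (u, 0) is, modulo K, the boundary of (w, v), and then v is again a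
   1-cycle with u = kd w + a v: Nakayama gives the vanishing of H_1 for s. *)
Theorem regseq_kacyclic K s :
  (forall a c, a \in s -> exists b, b * (1 - c * a) = 1) ->
  kacyclic K s 1 -> regseq fullI K (rev s).
Proof.
elim: s => [//|a s IH] inva acyc.
(* The head of the list is the generator adjoined last to the complex, so it comes last in the
   regular sequence: hence [rev]. *)
rewrite rev_cons; apply/regseq_rcons; split; last first.
  move=> z _; rewrite (@gens_perm _ K (rev s) s) => [|y]; last exact: mem_rev.
  move=> /gens_fullP[c /khomotopy_exists[h [hl hc hd hk]] Kc].
  (* Since a z = c modulo K with c in (s), and d(h 1) = c, the chain e z - h 1 is a cycle modulo K.
     If it bounds w + e v, the e-part reads z = - dv modulo K, and dv lies in (s). *)
  have [|/=|] := acyc (- h (kone _ 1), kone _ z).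
  - by split; [apply/kdegN/hd/kone_deg | apply: kone_deg].
  - split; last by rewrite kd_kdeg0 ?oppr0; [apply: kin0 | apply: kone_deg].
    have := hc (kone _ 1); rewrite (kd_kdeg0 (kone_deg _ _)).
    have h0 : h 0 = 0.
      have := hl (-1) 0 0; rewrite scaleN1r oppr0 addr0 => {1}->.
      by rewrite scaleN1r addNr.
    rewrite h0 addr0 kdN => e; rewrite /= e -scaleN1r !koneZ koneD.
    by apply/kin_kone; rewrite mulr1 mulN1r addrC.
  move=> [w v] [_ dv] /= [_ Kv]; have [d sd vd] := kd_deg1 dv.
  apply/gens_fullP; exists (- d); first by apply: smemN (seq_ideal _) _ _.
  by move: Kv; rewrite vd opprK koneD => /kin_kone; rewrite opprK.
apply: IH => [b c bs|u du Ku]; first by apply: inva; rewrite in_cons bs orbT.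
pose Z := fun u : kos (size s) => kdeg 1 u /\ kin K _ (kd u).
have Z0 : Z 0 by split; [apply: kdeg0 | rewrite kd0; apply: kin0].
have ZD u1 u2 : Z u1 -> Z u2 -> Z (u1 + u2).
  move=> [dx Kx] [dy Ky]; split; first exact: kdegD.
  by rewrite kdD; apply: smemD.
have ZZ b u1 : Z u1 -> Z (b *: u1).
  by move=> [dx Kx]; split; [apply: kdegZ | rewrite kdZ; apply: smemZ].
pose B := fun u : kos (size s) => exists2 v, kdeg 2 v & kin K _ (u - kd v).
have B0 : B 0 by exists 0; [apply: kdeg0 | rewrite kd0 subrr; apply: kin0].
have BD u1 u2 : B u1 -> B u2 -> B (u1 + u2).
  move=> [v dv Kv] [w dw Kw]; exists (v + w); first exact: kdegD.
  by rewrite kdD opprD addrACA; apply: smemD.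
have BZ b u1 : B u1 -> B (b *: u1).
  move=> [v dv Kv]; exists (b *: v); first exact: kdegZ.
  by rewrite kdZ -scalerBr; apply: smemZ.
apply: (@nakayama _ _ a (Submodule Z0 ZD ZZ) (Submodule B0 BD BZ)) => //.
- by move=> c; apply: inva; apply: mem_head.
- exact: noetherian_kos.
move=> {du Ku} {}u [du Ku].
have [||[w v] [dw dv]] := acyc (u, 0).
- by split=> //; apply: kdeg0.
- by rewrite /= scaler0 addr0 kd0 oppr0; split=> //; apply: kin0.
rewrite /= => -[Kwv]; rewrite sub0r opprK => Kv.
exists v; first by split.
by exists w => //; rewrite -addrA -opprD [a *: v + _]addrC.
Qed.

End Koszul.

(** * Primes and regular sequences in local rings *)

Section PrimeBelow.
Variable R : comPzRingType.
Implicit Types (K P Q : ideal R) (a x z : R) (s t : seq R).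

(* Q is maximal among the ideals above K that do not meet the multiplicative
   set of the a ^+ n * s with s outside P. *)
Lemma prime_below K P a : prime_ideal P -> sub_ideal K P ->
  (forall z, K (a * z) -> K z) ->
  exists Q, [/\ prime_ideal Q, sub_ideal K Q, sub_ideal Q P & ~ Q a].
Proof.
move=> [P1 Pp] KP Ka.
pose avoids (I : ideal R) := forall n u, ~ P u -> ~ I (a ^+ n * u).
pose good (A : set R) := A = set0 \/
  exists I : ideal R, [/\ A = I :> (R -> Prop), sub_ideal K I & avoids I].
have Kgood : good (K : set R).
  right; exists K; split=> // n u Ps Ks; apply: Ps; apply: KP.
  by elim: n Ks => [|n IH]; rewrite ?mul1r // exprS -mulrA => /Ka.
have [|A [Agood Amax]] := @Zorn_bigcup R good.
  move=> F Fgood Ftot.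
  have [F0|[B0 FB0 [z0 B0z0]]] :
      (\bigcup_(X in F) X)%classic = set0 \/ exists2 B, F B & exists z, B z.
    have [[B FB Bz]|noB] := pselect (exists2 B, F B & exists z, B z).
      by right; exists B.
    left; apply/seteqP; split=> // z [B FB Bz].
    by case: noB; exists B => //; exists z.
  - by left.
  have Fideal B z : F B -> B z ->
      exists I : ideal R, [/\ B = I :> (R -> Prop), sub_ideal K I & avoids I].
    by move=> /Fgood[->|].
  right; pose U : R^o -> Prop := (\bigcup_(X in F) X)%classic.
  have U0 : U 0.
    have [I [eB _ _]] := Fideal _ _ FB0 B0z0; exists B0 => //.
    by rewrite eB; apply: smem0.
  have UD x y : U x -> U y -> U (x + y).
    move=> [B FB Bx] [C FC Cy].
    have [I [eB _ _]] := Fideal _ _ FB Bx.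
    have [I' [eC _ _]] := Fideal _ _ FC Cy.
    have [BC|CB] := Ftot _ _ FB FC.
      exists C => //; move: (BC _ Bx) Cy; rewrite eC; exact: smemD.
    exists B => //; move: Bx (CB _ Cy); rewrite eB; exact: smemD.
  have UZ b (x : R^o) : U x -> U (b *: x).
    move=> [B FB Bx]; have [I [eB _ _]] := Fideal _ _ FB Bx.
    by exists B => //; move: Bx; rewrite eB; apply: smemZ.
  exists (Submodule U0 UD UZ); split=> // [z Kz|n u Ps [B FB Bs]].
    have [I [eB KI _]] := Fideal _ _ FB0 B0z0.
    by exists B0 => //; rewrite eB; apply: KI.
  by have [I [eB _]] := Fideal _ _ FB Bs; move: Bs; rewrite eB => Is /(_ _ _ Ps Is).
case: Agood => [A0|[Q [eA KQ Qav]]].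
  case: (Amax K) => //; rewrite A0; split=> // /(_ 0 (smem0 K)) //.
have Qmax (I : ideal R) : sub_ideal Q I -> avoids I -> sub_ideal I Q.
  move=> QI Iav z Iz; apply: contrapT => Qz; apply: (Amax I).
    by rewrite eA; split=> // /(_ z Iz).
  by right; exists I; split=> // y /KQ /QI.
have P1' : ~ P 1 := P1.
exists Q; split=> //.
- split=> [Q1|x y Qxy].
    by apply: (Qav 0%N 1 P1'); rewrite mulr1.
  apply: contrapT => /not_orP[Qx Qy].
  have meets w : ~ Q w -> exists n u c, ~ P u /\ Q (a ^+ n * u - w * c).
    move=> Qw; apply: contrapT => no; apply: Qw.
    apply: (Qmax (addm fullI Q w)) => [z|n u Ps [c _ Qc]|].
    - exact: addm_sub.
    - by apply: no; exists n, u, c.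
    - exact: addm_self.
  have [n [u [c [Ps Qs]]]] := meets _ Qx.
  have [n' [u' [c' [Ps' Qs']]]] := meets _ Qy.
  apply: (Qav (n + n')%N (u * u')) => [/Pp[]//|].
  have -> : a ^+ (n + n') * (u * u') = (a ^+ n' * u') * (a ^+ n * u - x * c) +
      x * c * (a ^+ n' * u' - y * c') + (c * c') * (x * y).
    by rewrite exprD; ring.
  by apply: smemD; [apply: smemD|]; apply: idealM.
- move=> z Qz; apply: contrapT => Pz.
  by apply: (Qav 0%N z Pz); rewrite mul1r.
- by move=> Qa; apply: (Qav 1%N 1 P1'); rewrite mulr1.
Qed.

(* Chains of prime ideals of R / K. *)
Definition chain_above K d : Prop := exists c : nat -> ideal R,
  (forall i, (i <= d)%N -> prime_ideal (c i) /\ sub_ideal K (c i)) /\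
  (forall i, (i < d)%N -> sub_ideal (c i) (c i.+1) /\ ~ sub_ideal (c i.+1) (c i)).

(** The chain is built downwards from P: the last element of [t] is a nonzerodivisor modulo the
    earlier ones, so [prime_below] yields a prime below P that omits it. This bounds depth by
    dimension. *)
Lemma regseq_chain K t P : regseq fullI K t -> prime_ideal P ->
  sub_ideal (gens fullI K t) P -> chain_above K (size t).
Proof.
move=> Kt Pp tP.
suff [c [c1 c2 _]] : exists c : nat -> ideal R,
  [/\ (forall i, (i <= size t)%N -> prime_ideal (c i) /\ sub_ideal K (c i)),
      (forall i, (i < size t)%N ->
         sub_ideal (c i) (c i.+1) /\ ~ sub_ideal (c i.+1) (c i))
    & c (size t) = P] by exists c.
elim/last_ind: t P Pp Kt tP => [|t a IH] P Pp.
  by move=> _ KP; exists (fun=> P).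
rewrite regseq_rcons gens_rcons size_rcons => -[Kt Ka] tP.
have [|z|Q [Qp tQ QP Qa]] := prime_below (K := gens fullI K t) (a := a) Pp.
- by move=> z tz; apply/tP/addm_sub.
- exact: Ka.
have [c [c1 c2 cQ]] := IH Q Qp Kt tQ.
exists (fun i => if (i <= size t)%N then c i else P); split=> [i|i|].
- case: ifP => [it _|_ _]; first exact: c1.
  split=> // z Kz; apply/tP/addm_sub; exact: gens_sub.
- rewrite ltnS; case: ltngtP => // [it|->] _; first exact: c2.
  by rewrite cQ; split=> // PQ; apply/Qa/PQ/tP; apply: addm_self.
- by rewrite ltnn.
Qed.

End PrimeBelow.

(** * Systems of parameters in a noetherian local ring *)

Section LocalRings.
Variables (R : comPzRingType) (m : ideal R).
Hypotheses (nR : noetherian R) (m_proper : proper m).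
Hypothesis m_local : forall x : R, ~ m x -> exists y : R, y * x = 1.
Implicit Types (B I J K N P Q : ideal R) (a x z : R) (s t : seq R).

Lemma sub1_inv a c : m a -> exists b, b * (1 - c * a) = 1.
Proof.
move=> ma; apply: m_local => mca; apply: m_proper.
by rewrite /proper -(subrK (c * a) 1); apply: smemD => //; apply: idealM.
Qed.

Lemma proper_sub_local K : proper K -> sub_ideal K m.
Proof.
move=> K1 z Kz; apply: contrapT => /m_local[y yz]; apply: K1.
by rewrite -yz; apply: idealM.
Qed.

Lemma local_prime : prime_ideal m.
Proof.
split=> // x y mxy; apply: contrapT => /not_orP[/m_local[u ux] /m_local[v vy]].
apply: m_proper; rewrite /proper -[1]mulr1 -{1}ux -vy.
have -> : u * x * (v * y) = u * v * (x * y) by ring.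
exact: idealM.
Qed.

Lemma nakayama_ideal a N B : m a ->
  (forall x, N x -> exists2 y, N y & B (x - a * y)) -> sub_ideal N B.
Proof.
move=> ma NB; apply: (@nakayama R R^o a N B) => // c; exact: sub1_inv.
Qed.

(** [t] is as long as [s], which is exactly what [kacyclic_regular] needs for H_1(s; R / K) = 0. The
    complex is taken on [rev s], to undo the reversal in [regseq_kacyclic]. *)
Lemma sop_regular K s t :
  regseq fullI K t -> (forall a, a \in t -> m a) ->
  size s = size t -> (forall a, a \in s -> m a) ->
  (forall a, m a -> exists n, gens fullI K s (a ^+ n)) ->
  regseq fullI K s.
Proof.
move=> Kt tm st sm ms; rewrite -[s]revK; apply: regseq_kacyclic => //.
  by move=> a c; rewrite mem_rev => /sm; apply: sub1_inv.
apply: (kacyclic_regular Kt) => [a /tm /ms[n sn]|].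
  by exists n; rewrite (@gens_perm _ K (rev s) s) // => y; rewrite mem_rev.
by rewrite size_rev st.
Qed.

(** Write s = s', a. As [a] is a nonzerodivisor modulo J + (s'), there is a prime Q with J + (s') <=
    Q <= I + (s) and [a] outside Q. It contains I, which is nil modulo J, and Nakayama gives Q = I +
    (s'). So this ideal is prime and omits [a], and the argument repeats with s'; it starts from the
    primality of m = I + (s). *)
Lemma regseq_nil_extension I J s :
  sub_ideal J I -> (forall z, I z -> exists n, J (z ^+ n)) ->
  (forall a, a \in s -> m a) -> (forall z, m z <-> gens fullI I s z) ->
  regseq fullI J s -> regseq fullI I s.
Proof.
move=> JI IJ sm ms; have : prime_ideal (gens fullI I s).
  have <- : m = gens fullI I s by apply: submodule_ext.
  exact: local_prime.
move: sm {ms}; elim/last_ind: s => [//|s a IH] sm.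
rewrite !regseq_rcons gens_rcons => Pp [Js Ja].
have [||Q [Qp sQ QP Qa]] := prime_below (K := gens fullI J s) (a := a) Pp.
- by move=> z sz; apply: addm_sub; apply: gens_mono sz.
- by move=> z; apply: Ja.
have eQ : gens fullI I s = Q.
  have sIQ : sub_ideal (gens fullI I s) Q.
    apply: gens_min => [z /IJ[n Jn]|b z bs _].
      have : Q (z ^+ n) by apply: sQ; apply: gens_sub.
      case: Qp => Q1 Qp; elim: n {Jn} => [|n IHn]; first by rewrite expr0 => /Q1.
      by rewrite exprS => /Qp[].
    by apply: sQ; apply: gens_mul.
  apply: submodule_ext => z; split; first exact: sIQ.
  (* An element of Q is a c modulo I + (s'), and c is in Q because [a] is not: so Q = a Q modulo I +
     (s'). *)
  apply: (nakayama_ideal (a := a)); first by apply: sm; rewrite mem_rcons mem_head.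
  move=> x Qx; have [c _ xc] := QP _ Qx; exists c => //.
  have [_ /(_ a c)[]//] := Qp.
  by rewrite -(subKr x (a * c)); apply: smemB => //; apply: sIQ.
split=> [|z _]; last by rewrite eQ; case: Qp => _ /[apply]-[].
by apply: IH; rewrite ?eQ // => b bs; apply: sm; rewrite mem_rcons in_cons bs orbT.
Qed.

End LocalRings.

(** * Regular sequences along 0 -> J / J' -> R / J' -> R / J -> 0 *)

Section ExactSequence.
Variable R : comPzRingType.
Variables (J J' : ideal R).
Hypothesis J'J : sub_ideal J' J.
Implicit Types (a z : R) (s : seq R).

Lemma gens_full_split s z : gens fullI J s z ->
  exists2 y, J y & gens fullI J' s (z - y).
Proof.
move=> /gens_fullP[c sc Jc]; exists (z - c) => //; rewrite subKr.
by apply/gens_fullP; exists c; rewrite ?subrr //; apply: smem0.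
Qed.

(** The vanishing of Tor_1(R / (s), R / J) in elementary terms: J / J' -> R / J' stays injective
    modulo (s). It is the step common to passing regularity to the extension and to the kernel. *)
Lemma gens_meet s z : regseq fullI J s -> J z -> gens fullI J' s z -> gens J J' s z.
Proof.
elim/last_ind: s z => [//|s a IH] z; rewrite regseq_rcons !gens_rcons.
move=> [Js Ja] Jz [c _ zc].
have Jac : gens fullI J s (a * c).
  rewrite -(subKr z (a * c)); apply: smemB; first exact: gens_sub.
  exact: gens_mono zc.
have [y Jy cy] := gens_full_split (Ja c Logic.I Jac).
exists y => //; apply: IH => //; first by apply: smemB => //; apply: idealM.
have -> : z - a * y = (z - a * c) + a * (c - y) by ring.
by apply: smemD => //; apply: idealM.
Qed.

Lemma regseq_extension s : regseq J J' s -> regseq fullI J s -> regseq fullI J' s.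
Proof.
elim/last_ind: s => [//|s a IH]; rewrite !regseq_rcons.
move=> [J's J'a] [Js Ja]; split=> [|z _ za]; first exact: IH.
have [|y Jy zy] := gens_full_split (z := z) (s := s).
  by apply: Ja => //; apply: gens_mono za.
apply: (smem_sub zy); apply: (@gens_mono _ J fullI J' J') => //.
apply: J'a => //; apply: gens_meet => //; first exact: idealM.
have -> : a * y = a * z - a * (z - y) by ring.
by apply: smemB => //; apply: idealM.
Qed.

Lemma regseq_kernel s : regseq fullI J s -> regseq fullI J' s -> regseq J J' s.
Proof.
elim/last_ind: s => [//|s a IH]; rewrite !regseq_rcons.
move=> [Js Ja] [J's J'a]; split=> [|z Jz za]; first exact: IH.
by apply: gens_meet => //; apply: J'a => //; apply: gens_mono za.
Qed.

End ExactSequence.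

(** * Freeness of a quotient *)

Lemma spans_sum (R : comPzRingType) (M : lmodType R) (s : seq M) x :
  spans s x -> exists c : 'I_(size s) -> R, x = \sum_i c i *: s`_i.
Proof.
elim: s x => [|a s IH] x.
  by move=> /spans_nil ->; exists (fun=> 0); rewrite big_ord0.
move=> /spans_cons[b [y [/IH[c ->] ->]]].
exists (fun i => if unlift ord0 i is Some j then c j else b).
rewrite big_ord_recl unlift_none /=; congr (_ + _).
by apply: eq_bigr => i _; rewrite liftK.
Qed.

Section FreeQuotient.
Variable R : comPzRingType.
Variables (I J J' : ideal R).
Implicit Types (a x z : R) (s t : seq R).

(* J / J' is a free module over R / I. *)
Definition free_over : Prop := exists r (e : 'I_r -> R),
  [/\ forall i, J (e i),
      forall z, J z -> exists c : 'I_r -> R, J' (z - \sum_i c i * e i)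
    & forall c : 'I_r -> R, J' (\sum_i c i * e i) -> forall i, I (c i)].

Hypothesis IJ : forall a b : R, I a -> J b -> J' (a * b).

Lemma gens_scale s (c b : R) : gens fullI I s c -> J b -> gens J J' s (c * b).
Proof.
move=> sc Jb.
pose Q := fun c : R^o => gens J J' s ((c : R) * b).
have Q0 : Q 0 by rewrite /Q mul0r; apply: smem0.
have QD x y : Q x -> Q y -> Q (x + y).
  by rewrite /Q mulrDl; apply: smemD.
have QZ a (x : R^o) : Q x -> Q (a *: x).
  by move=> Qx; rewrite /Q -mulrA; apply: idealM.
suff : sub_ideal (gens fullI I s) (Submodule Q0 QD QZ) by apply.
apply: gens_min => [z Iz|a z sa _]; rewrite /= /Q.
  by apply: gens_sub; apply: IJ.
by rewrite -mulrA; apply: gens_mul => //; apply: idealM.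
Qed.

Section Basis.
Variables (r : nat) (e : 'I_r -> R).
Hypothesis Je : forall i, J (e i).

Lemma sum_ideal c : J (\sum_i c i * e i).
Proof. by apply: smem_sum => i _; apply: idealM. Qed.

Lemma gens_comb s (c : 'I_r -> R) : (forall i, gens fullI I s (c i)) ->
  gens J J' s (\sum_i c i * e i).
Proof. by move=> sc; apply: smem_sum => i _; apply: gens_scale. Qed.

Lemma sum_combB (c d : 'I_r -> R) a :
  \sum_i (c i - a * d i) * e i = \sum_i c i * e i - a * \sum_i d i * e i.
Proof.
by rewrite mulr_sumr -sumrB; apply: eq_bigr => i _; rewrite mulrBl mulrA.
Qed.

Hypothesis e_gen :
  forall z, J z -> exists c : 'I_r -> R, J' (z - \sum_i c i * e i).

(** A basis of J / J' over R / I remains independent after reduction modulo (s); each element of [s]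
    is split off by expanding its cofactor in the basis. *)
Lemma basis_gens s (c : 'I_r -> R) :
  (forall c : 'I_r -> R, J' (\sum_i c i * e i) -> forall i, I (c i)) ->
  gens J J' s (\sum_i c i * e i) -> forall i, gens fullI I s (c i).
Proof.
move=> e_free; elim/last_ind: s c => [|s a IH] c; first exact: e_free.
rewrite !gens_rcons => -[y Jy sy] i; have [d yd] := e_gen Jy.
exists (d i) => //; apply: (IH (fun i => c i - a * d i)).
rewrite sum_combB.
set S1 := \sum_i _ in sy *; set S2 := \sum_i _ in yd *.
have -> : S1 - a * S2 = (S1 - a * y) + a * (y - S2) by ring.
by apply: smemD => //; apply: idealM; apply: gens_sub.
Qed.

End Basis.

Lemma regseq_free s : free_over -> regseq fullI I s -> regseq J J' s.
Proof.
move=> [r [e [Je e_gen e_free]]].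
elim/last_ind: s => [//|s a IH]; rewrite !regseq_rcons.
move=> [Is Ia]; split=> [|z Jz sz]; first exact: IH.
have [c zc] := e_gen z Jz; apply: (ideal_sub (z := \sum_i c i * e i)).
  exact: gens_sub.
apply: gens_comb => // i; apply: Ia => //.
apply: (@basis_gens r e e_gen s (fun i => a * c i)) i => //.
under eq_bigr => i _ do rewrite -mulrA.
rewrite -mulr_sumr; set S := \sum_i _ in zc *.
have -> : a * S = a * z - a * (z - S) by ring.
by apply: smemB => //; apply: idealM; apply: gens_sub.
Qed.

Variable m : ideal R.
Hypotheses (nR : noetherian R) (m_proper : proper m).
Hypothesis m_local : forall x : R, ~ m x -> exists y : R, y * x = 1.

Lemma gens_nakayama N s : (forall a, a \in s -> m a) ->
  sub_ideal J (gens J N s) -> sub_ideal J N.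
Proof.
elim/last_ind: s => [//|s a IH] sm; rewrite gens_rcons => Ja.
apply: IH => [b bs|]; first by apply: sm; rewrite mem_rcons in_cons bs orbT.
apply: (nakayama_ideal nR m_proper m_local (a := a)) => //.
by apply: sm; rewrite mem_rcons mem_head.
Qed.

(** The number r of generators is taken least: a relation with a unit coefficient would allow one of
    them to be dropped, by Nakayama. Relations are taken modulo J' + (s) J and not only modulo J',
    because this is where the descent in [free_regseq] starts. *)
Lemma minimal_gens s : (forall a, a \in s -> m a) ->
  exists r (e : 'I_r -> R), [/\ forall i, J (e i),
    forall z, J z -> exists c : 'I_r -> R, J' (z - \sum_i c i * e i)
  & forall c : 'I_r -> R, gens J J' s (\sum_i c i * e i) -> forall i, m (c i)].
Proof.
move=> sm.
pose gen r := `[< exists e : 'I_r -> R, (forall i, J (e i)) /\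
  forall z, J z -> exists c : 'I_r -> R, J' (z - \sum_i c i * e i) >].
have ex_gen : exists r, gen r.
  have [l lP] := nR J; exists (size l); apply/asboolP.
  exists (fun i => l`_i); split=> [i|z /lP/spans_sum[c ->]].
    by apply/lP/span_incl/mem_nth.
  by exists c; rewrite subrr; apply: smem0.
have [r /asboolP[e [Je e_gen]] rmin] := ex_minnP ex_gen.
exists r, e; split=> // c sc i; apply: contrapT => /m_local[b bc].
case: r e i c Je e_gen rmin sc bc => [|r] e i c Je e_gen rmin sc bc.
  by case: i {bc}.
suff /rmin : gen r by rewrite ltnn.
apply/asboolP; exists (fun j => e (lift i j)); split=> [j|]; first exact: Je.
pose N := fun z : R^o => exists c : 'I_r -> R,
  J' ((z : R) - \sum_j c j * e (lift i j)).
have N0 : N 0.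
  exists (fun=> 0); rewrite big1 ?subr0; first exact: smem0.
  by move=> j _; rewrite mul0r.
have ND x y : N x -> N y -> N (x + y).
  move=> [d xd] [f yf]; exists (fun j => d j + f j).
  under eq_bigr do rewrite mulrDl.
  by rewrite big_split /= opprD addrACA; apply: smemD.
have NZ a (x : R^o) : N x -> N (a *: x).
  move=> [d xd]; exists (fun j => a * d j).
  under eq_bigr do rewrite -mulrA.
  by rewrite -mulr_sumr -mulrBr; apply: idealM.
pose NI := Submodule N0 ND NZ.
suff : sub_ideal J NI by [].
apply: (gens_nakayama sm) => z Jz.
have J'N : sub_ideal J' NI.
  move=> x J'x; exists (fun=> 0); rewrite big1 ?subr0 // => j _.
  by rewrite mul0r.
have Ne j : NI (e (lift i j)).
  exists (fun k => (k == j)%:R); rewrite (bigD1 j) //= eqxx mul1r big1 ?addr0.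
    by rewrite subrr; apply: smem0.
  by move=> k /negbTE ->; rewrite mul0r.
have se k : gens J NI s (e k).
  have [j ->|->] := unliftP i k; first exact: gens_sub.
  (* The relation is solved for [e i], [b] being the inverse of its coefficient. *)
  have -> : e i = b * (\sum_k c k * e k) -
      b * \sum_j c (lift i j) * e (lift i j).
    rewrite (bigD1_ord i) //= mulrDr addrK mulrA bc mul1r //.
  apply: smemB; apply: idealM; first exact: gens_mono sc.
  by apply: smem_sum => j _; apply: idealM; apply: gens_sub.
have [d zd] := e_gen z Jz; apply: (ideal_sub (z := \sum_i d i * e i)).
  by apply: gens_sub; apply: J'N.
by apply: smem_sum => k _; apply: idealM.
Qed.

(** The elements of [s] are shed from the end, while coefficients of relations modulo J' + (s) J
    stay in I + (s); for the full [s] this is minimality, for the empty list it is freeness. To shed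
    [a], write a relation as c = a d modulo I + (s'). As [a] is regular on J / (J' + (s') J), d is
    again a relation, so the module of relations equals a times itself up to rows over I + (s'), and
    Nakayama applies in R^r. *)
Theorem free_regseq s : (forall a, a \in s -> m a) ->
  (forall z, m z -> gens fullI I s z) -> regseq J J' s -> free_over.
Proof.
move=> sm ms; have [r [e [Je e_gen e_min]]] := minimal_gens sm.
move=> Js; exists r, e; split=> //.
have : forall c : 'I_r -> R, gens J J' s (\sum_i c i * e i) ->
    forall i, gens fullI I s (c i) by move=> c sc i; apply/ms/e_min.
move: sm Js {ms e_min}; elim/last_ind: s => [//|s a IH] sm.
rewrite regseq_rcons => -[Js Ja] claim.
apply: IH => [b bs||] //; first by apply: sm; rewrite mem_rcons in_cons bs orbT.
have ma : m a by apply: sm; rewrite mem_rcons mem_head.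
pose C (v : 'rV[R]_r) := \sum_i v 0 i * e i.
have CD v w : C (v + w) = C v + C w.
  by rewrite -big_split; apply: eq_bigr => i _; rewrite mxE mulrDl.
have CZ b v : C (b *: v) = b * C v.
  by rewrite mulr_sumr; apply: eq_bigr => i _; rewrite mxE mulrA.
have C0 : C 0 = 0 by rewrite -(scale0r 0) CZ mul0r.
pose N v := gens J J' s (C v).
have N0 : N 0 by rewrite /N C0; apply: smem0.
have ND v w : N v -> N w -> N (v + w) by rewrite /N CD; apply: smemD.
have NZ b v : N v -> N (b *: v) by rewrite /N CZ; apply: idealM.
pose B (v : 'rV[R]_r) := forall i, gens fullI I s (v 0 i).
have B0 : B 0 by move=> i; rewrite mxE; apply: smem0.
have BD v w : B v -> B w -> B (v + w).
  by move=> Bv Bw i; rewrite mxE; apply: smemD.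
have BZ b v : B v -> B (b *: v).
  by move=> Bv i; rewrite mxE; apply: idealM.
move=> c sc i.
suff /(_ i) : B (\row_i c i) by rewrite mxE.
apply: (@nakayama _ _ a (Submodule N0 ND NZ) (Submodule B0 BD BZ)).
- by move=> b; apply: sub1_inv ma.
- exact: noetherian_rV.
- move=> v Nv.
  have /choice[d dP] : forall j, exists d, gens fullI I s (v 0 j - a * d).
    move=> j; have := claim (fun j => v 0 j); rewrite !gens_rcons.
    by move=> /(_ (addm_sub _ _ Nv) j)[d _ ?]; exists d.
  have Bvd : B (v - a *: \row_j d j) by move=> j; rewrite !mxE.
  exists (\row_j d j) => //; apply: Ja; first exact: sum_ideal.
  rewrite /= -CZ -(subKr v (a *: _)) CD -scaleN1r CZ mulN1r.
  by apply: smemB => //; apply: gens_comb.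
- by rewrite /= /N /C; under eq_bigr do rewrite mxE.
Qed.

End FreeQuotient.

(** * Cohen-Macaulay quotients of a local ring *)

Section QuotientRings.
Variables (R : comPzRingType) (K : ideal R).
Local Notation C := (quot_ring K).
Local Notation q := (to_quot K).
Implicit Types (a x z : R) (s t : seq R) (N : ideal C) (J : ideal R).

Lemma to_quot0 : q 0 = 0.
Proof. exact: quot_pi0. Qed.

Lemma to_quot1 : q 1 = 1.
Proof. by []. Qed.

Lemma to_quotB x z : q (x - z) = q x - q z.
Proof. by apply: (addIr (q z)); rewrite -to_quotD !subrK. Qed.

Lemma to_quot_eq0 x : q x = 0 <-> K x.
Proof. by rewrite -to_quot0 to_quot_eqP subr0. Qed.

Lemma quot_lift (u : seq C) : exists t, u = map q t.
Proof.
elim: u => [|c u [t ->]]; first by exists [::].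
by have [a ->] := to_quotP c; exists (a :: t).
Qed.

Section Preimage.
Variable N : ideal C.
Definition pre_mem (x : R^o) : Prop := N (q x).
Fact pre0 : pre_mem 0.
Proof. by rewrite /pre_mem to_quot0; apply: smem0. Qed.
Fact preD x z : pre_mem x -> pre_mem z -> pre_mem (x + z).
Proof. by rewrite /pre_mem to_quotD; apply: smemD. Qed.
Fact preZ a (x : R^o) : pre_mem x -> pre_mem (a *: x).
Proof. by rewrite /pre_mem to_quotMr; apply: idealM. Qed.
Definition pre_ideal : ideal R := Submodule pre0 preD preZ.
End Preimage.

Lemma pre_quot_ideal J x : sub_ideal K J -> quot_ideal K J (q x) <-> J x.
Proof.
move=> KJ; split=> [[z Jz /to_quot_eqP /KJ]|Jx]; last by exists x.
by move/ideal_sub; apply.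
Qed.

Lemma seq_ideal_quot s x : seq_ideal (map q s) (q x) <-> gens fullI K s x.
Proof.
split=> [sx|/gens_fullP[c sc /to_quot_eqP ->]]; last first.
  suff : sub_ideal (seq_ideal s) (pre_ideal (seq_ideal (map q s))) by apply.
  by move=> z; apply=> a sa; apply: span_incl; apply: map_f.
apply/(@pre_quot_ideal (gens fullI K s)); first exact: gens_sub.
apply: sx => _ /mapP[a sa ->].
by exists a => //; rewrite -[a]mulr1; apply: gens_mul.
Qed.

Lemma prime_quot N : prime_ideal N <-> prime_ideal (pre_ideal N).
Proof.
split=> [[N1 Np]|[N1 Np]]; split=> //.
  by move=> x y; rewrite /= /pre_mem to_quotMr; apply: Np.
move=> x y; have [[a ->] [b ->]] := (to_quotP x, to_quotP y).
by rewrite -to_quotMr; apply: Np.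
Qed.

Lemma prime_quot_ideal J : sub_ideal K J -> prime_ideal J ->
  prime_ideal (quot_ideal K J).
Proof.
move=> KJ Jp; apply/prime_quot.
by have -> : pre_ideal (quot_ideal K J) = J
  by apply: submodule_ext => x; apply: pre_quot_ideal.
Qed.

Lemma noetherian_quot : noetherian R -> noetherian C.
Proof.
move=> nR N; have [s sP] := nR (pre_ideal N); exists (map q s) => y.
have [x ->] := to_quotP y; rewrite seq_ideal_quot gens_fullP.
split=> [Nx|[c sc Kxc]].
  exists x; first exact/sP.
  by rewrite subrr; apply: smem0.
have -> : q x = q c by apply/to_quot_eqP.
exact: (sP c).2 sc.
Qed.

Lemma prime_chain_quot d : prime_chain C d <-> chain_above K d.
Proof.
split=> [[c [c1 c2]]|[c [c1 c2]]].
  exists (fun i => pre_ideal (c i)); split=> [i id|i id].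
    split; first by apply/prime_quot/c1.
    by move=> z /to_quot_eq0 e; rewrite /= /pre_mem e; apply: smem0.
  have [cc ncc] := c2 i id; split=> [z|ccc]; first exact: cc.
  by apply: ncc => y; have [x ->] := to_quotP y; apply: ccc.
exists (fun i => quot_ideal K (c i)); split=> [i id|i id].
  by have [cp Kc] := c1 i id; apply: prime_quot_ideal.
have [cc ncc] := c2 i id; split=> [_ [z cz ->]|ccc]; first by exists z; [apply: cc|].
have [_ Kci] := c1 i (ltnW id); have [_ Kci1] := c1 i.+1 id.
by apply: ncc => z /(pre_quot_ideal z Kci1)/ccc/(pre_quot_ideal z Kci).
Qed.

Lemma regular_sequence_quot s : regular_sequence (map q s) <->
  regseq fullI K s /\ proper (gens fullI K s).
Proof.
have pE : proper (seq_ideal (map q s)) <-> proper (gens fullI K s).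
  by rewrite /proper -to_quot1 seq_ideal_quot.
rewrite /regular_sequence pE regseqP size_map.
split=> -[h1 h2]; split=> // i it.
  move=> z _ /seq_ideal_quot h; apply/seq_ideal_quot; rewrite map_take.
  apply: h1 => //; rewrite -map_take (nth_map 0) // -to_quotMr.
  exact: h.
move=> y; have [x ->] := to_quotP y.
rewrite (nth_map 0) // -to_quotMr -map_take !seq_ideal_quot.
exact: h1.
Qed.

Variable m : ideal R.
Hypotheses (nR : noetherian R) (m_proper : proper m).
Hypothesis m_local : forall x : R, ~ m x -> exists y : R, y * x = 1.
Hypothesis Km : sub_ideal K m.

Lemma quot_local_maximal : maximal_ideal (quot_ideal K m).
Proof.
split=> [|N N1 mN y].
  by rewrite /proper -to_quot1 pre_quot_ideal.
have [x ->] := to_quotP y => Nx; apply/pre_quot_ideal => //.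
by apply: (@proper_sub_local _ _ m_local (pre_ideal N)).
Qed.

Lemma quot_maximal_unique N : maximal_ideal N ->
  forall y, N y <-> quot_ideal K m y.
Proof.
move=> [N1 Nmax].
have Nm : sub_ideal N (quot_ideal K m).
  move=> y; have [x ->] := to_quotP y => Nx; apply/pre_quot_ideal => //.
  by apply: (@proper_sub_local _ _ m_local (pre_ideal N)).
move=> y; split; [exact: Nm | apply: Nmax => //].
by case: quot_local_maximal.
Qed.

Lemma quot_noetherian_local : noetherian_local (quot_ideal K m).
Proof.
split; [exact: noetherian_quot | exact: quot_local_maximal |].
by move=> N Nmax x; apply: quot_maximal_unique.
Qed.

Definition dim_above d :=
  chain_above K d /\ forall e, chain_above K e -> (e <= d)%N.

Lemma krull_dim_quot d : krull_dim C d <-> dim_above d.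
Proof.
rewrite /krull_dim prime_chain_quot /dim_above.
by split=> -[h1 h2]; split=> // e /prime_chain_quot/h2.
Qed.

(** Maximality of the depth is automatic on the right: by [regseq_chain], no regular sequence is
    longer than the dimension. *)
Lemma cohen_macaulay_quot : cohen_macaulay_ring C <->
  exists t, [/\ forall a, a \in t -> m a, regseq fullI K t & dim_above (size t)].
Proof.
split=> [[n [d [[_ nmax _] /krull_dim_quot dim [[u [ud un]]]]]]|[t [tm Kt dim]]].
  have [t eu] := quot_lift u; rewrite {}eu size_map in ud un *.
  move=> /regular_sequence_quot[Kt _] _; exists t; split=> //; last by rewrite ud.
  move=> a ta; apply/(pre_quot_ideal a Km)/(quot_maximal_unique nmax)/un.
  exact: map_f.
exists (quot_ideal K m), (size t); split.
- exact: quot_noetherian_local.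
- exact/krull_dim_quot.
split=> [|e [u [ue um]]].
  exists (map q t); split; rewrite ?size_map //.
    by move=> _ /mapP[a /tm ma ->]; exists a.
  apply/regular_sequence_quot; split=> // gens1; apply: m_proper.
  by apply: gens_min gens1 => // a z /tm ma _; apply: idealMr.
have [s es] := quot_lift u; rewrite {}es size_map in ue um *.
move=> /regular_sequence_quot[Ks _]; apply: (dim.2); rewrite -ue.
apply: (regseq_chain Ks (local_prime m_proper m_local)).
apply: gens_min => // a z sa _; apply: idealMr.
by apply/(pre_quot_ideal a Km)/um/map_f.
Qed.

Lemma regular_local_quot : regular_local_ring C ->
  exists s, (forall z, m z <-> gens fullI K s z) /\ dim_above (size s).
Proof.
move=> [n [d [[_ nmax _] /krull_dim_quot dim [u [ud un]]]]].
have [s eu] := quot_lift u; rewrite {}eu size_map in ud un *.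
exists s; rewrite ud; split=> // z.
by rewrite -seq_ideal_quot -un (quot_maximal_unique nmax) pre_quot_ideal.
Qed.

End QuotientRings.

(** * The local statement for three ideals J' <= J <= I *)

Section LocalCriterion.
Variables (R : comPzRingType) (m : ideal R).
Hypotheses (nR : noetherian R) (m_proper : proper m).
Hypothesis m_local : forall x : R, ~ m x -> exists y : R, y * x = 1.
Variables (I J J' : ideal R).
Hypotheses (Im : sub_ideal I m) (JI : sub_ideal J I) (J'J : sub_ideal J' J).
Hypothesis IJ : forall a b : R, I a -> J b -> J' (a * b).
Hypothesis I_nil : forall z : R, I z -> exists n, J' (z ^+ n).
Hypothesis I_regular : regular_local_ring (quot_ring I).

(** I is nil modulo K, so the primes above K are those above I. *)
Lemma dim_above_nil (K : ideal R) d : sub_ideal K I ->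
  (forall z : R, I z -> exists n, K (z ^+ n)) -> dim_above I d <-> dim_above K d.
Proof.
move=> KI nilK.
have chE e : chain_above I e <-> chain_above K e.
  split=> -[c [c1 c2]]; exists c; split=> // i ie; have [cp sc] := c1 i ie.
    by split=> // z /KI/sc.
  split=> // z /nilK[n /sc]; case: cp => c0 cp; elim: n => [|n IH].
    by rewrite expr0 => /c0.
  by rewrite exprS => /cp[].
by split=> -[h1 h2]; split=> [|e /chE]; [apply/chE|apply: h2|apply/chE|apply: h2].
Qed.

(** Here [sop_regular] compares [s] with the regular sequence given by Cohen-Macaulayness. The
    lengths agree as both are the dimension of R / K, and [s] generates m up to radical modulo K
    because m = I + (s) and I is nil modulo K. *)
Lemma parameters_regular (K : ideal R) s : sub_ideal K I ->
  (forall z : R, I z -> exists n, K (z ^+ n)) ->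
  (forall z, m z <-> gens fullI I s z) -> dim_above I (size s) ->
  cohen_macaulay_ring (quot_ring K) -> regseq fullI K s.
Proof.
move=> KI nilK ms dim_s.
have Km : sub_ideal K m by move=> z /KI /Im.
move/(cohen_macaulay_quot nR m_proper m_local Km) => [t [tm Kt dim_t]].
have sm a : a \in s -> m a.
  by move=> sa; apply/ms; rewrite -[a]mulr1; apply: gens_mul.
apply: (sop_regular nR m_proper m_local Kt tm) => // [|a /ms].
  have [c1 h1] := (dim_above_nil _ KI nilK).1 dim_s; have [c2 h2] := dim_t.
  by apply/eqP; rewrite eqn_leq h1 ?h2.
move=> /gens_fullP[c sc /nilK[n Kn]].
have sKc : gens fullI K s c.
  by apply/gens_fullP; exists c; rewrite ?subrr //; apply: smem0.
(* a - c is in I and its n-th power in K; the remaining difference is divisible by a - (a - c) =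
   c. *)
exists n; have -> : a ^+ n = (a - c) ^+ n + (a ^+ n - (a - c) ^+ n) by ring.
apply: smemD; first exact: gens_sub.
by rewrite subrXX subKr; apply: idealMr.
Qed.

Lemma system_of_parameters :
  exists s, [/\ forall a, a \in s -> m a, forall z, m z <-> gens fullI I s z
              & dim_above I (size s)].
Proof.
have [s [ms dim_s]] := regular_local_quot m_proper m_local Im I_regular.
by exists s; split=> // a sa; apply/ms; rewrite -[a]mulr1; apply: gens_mul.
Qed.

Let J_nil z : I z -> exists n, J (z ^+ n).
Proof. by move=> /I_nil[n /J'J]; exists n. Qed.

Let J'I : sub_ideal J' I.
Proof. by move=> z /J'J /JI. Qed.

Theorem cohen_macaulay_extension : cohen_macaulay_ring (quot_ring J) ->
  free_over I J J' -> cohen_macaulay_ring (quot_ring J').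
Proof.
move=> J_cm L_free; have [s [sm ms dim_s]] := system_of_parameters.
have Js := parameters_regular JI J_nil ms dim_s J_cm.
have Is := regseq_nil_extension nR m_proper m_local JI J_nil sm ms Js.
apply/(cohen_macaulay_quot nR m_proper m_local (m := m)) => [z /J'I /Im//|].
exists s; split=> //; last exact/(dim_above_nil _ J'I I_nil).
by apply: (regseq_extension J'J) => //; apply: (regseq_free IJ).
Qed.

Theorem free_cohen_macaulay : cohen_macaulay_ring (quot_ring J) ->
  cohen_macaulay_ring (quot_ring J') -> free_over I J J'.
Proof.
move=> J_cm J'_cm; have [s [sm ms dim_s]] := system_of_parameters.
have Js := parameters_regular JI J_nil ms dim_s J_cm.
have J's := parameters_regular J'I I_nil ms dim_s J'_cm.
apply: (free_regseq IJ nR m_proper m_local sm) => [z /ms//|].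
exact: regseq_kernel.
Qed.

End LocalCriterion.

(** * Hilbert's basis theorem *)

Section HilbertBasis.

Lemma noetherian_ring_surj (A B : comNzRingType) (f : {rmorphism A -> B}) :
  (forall y, exists x, f x = y) -> noetherian A -> noetherian B.
Proof.
move=> f_surj nA N.
have pull (J : ideal B) : exists I : ideal A, forall x, I x <-> J (f x).
  have P0 : J (f 0) by rewrite rmorph0; apply: smem0.
  have PD x y : J (f x) -> J (f y) -> J (f (x + y)).
    by rewrite rmorphD; apply: smemD.
  have PZ a x : J (f x) -> J (f (a * x)).
    by rewrite rmorphM; apply: idealM.
  by exists (@Submodule A A^o (fun x => J (f x)) P0 PD PZ).
have [I IE] := pull N; have [s sP] := nA I; exists (map f s) => y.
have [x <-] := f_surj y; split=> [/IE/sP sx|fx].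
  have [I' I'E] := pull (seq_ideal (map f s)); apply/I'E.
  by apply: sx => z sz; apply/I'E; apply: span_incl; apply: map_f.
by apply: fx => _ /mapP[z sz ->]; apply/IE/sP/span_incl.
Qed.

Section Poly.
Variable A : comNzRingType.
Implicit Types (N T : ideal {poly A}) (p q : {poly A}) (a b : A).

Section CoefIdeal.
Variables (N : ideal {poly A}) (i : nat).
(** Coefficients of degree i of the members of N of degree at most i; a smaller degree is allowed,
    so that 0 and sums are included. *)
Definition coef_mem (a : A^o) : Prop :=
  exists p : {poly A}, [/\ N p, (size p <= i.+1)%N & p`_i = a].
Fact coef_mem0 : coef_mem 0.
Proof. by exists 0; split; rewrite ?size_poly0 ?coef0 //; apply: smem0. Qed.
Fact coef_memD a b : coef_mem a -> coef_mem b -> coef_mem (a + b).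
Proof.
move=> [p [Np sp <-]] [q [Nq sq <-]]; exists (p + q); split.
- exact: smemD.
- by apply: leq_trans (size_polyD _ _) _; rewrite geq_max sp.
- by rewrite coefD.
Qed.
Fact coef_memZ c (a : A^o) : coef_mem a -> coef_mem (c *: a).
Proof.
move=> [p [Np sp <-]]; exists (c *: p); split.
- by rewrite -mul_polyC; apply: idealM.
- exact: leq_trans (size_scale_leq _ _) sp.
- by rewrite coefZ.
Qed.
Definition coef_ideal : ideal A := Submodule coef_mem0 coef_memD coef_memZ.
End CoefIdeal.

Lemma coef_ideal_mono N i j : (i <= j)%N ->
  sub_ideal (coef_ideal N i) (coef_ideal N j).
Proof.
move=> ij a [p [Np sp <-]]; exists ('X^(j - i) * p); split.
- exact: idealM.
- apply: leq_trans (size_polyMleq _ _) _; rewrite size_polyXn /=.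
  by apply: leq_trans (leq_add (leqnn _) sp) _; rewrite addnS subnK.
- by rewrite coefXnM ltnNge leq_subr /= subKn.
Qed.

(** The union of the increasing coefficient ideals is finitely generated, hence reached at some
    degree M. Polynomials realizing generators of the ideals of degrees 0 to M realize all
    coefficient ideals of N, and subtracting a combination with the same top coefficient lowers the
    degree. *)
Lemma noetherian_poly : noetherian A -> noetherian {poly A}.
Proof.
move=> nA N.
pose U := fun a : A^o => exists i, coef_ideal N i a.
have U0 : U 0 by exists 0%N; apply: smem0.
have UD a b : U a -> U b -> U (a + b).
  move=> [i Na] [j Nb]; exists (maxn i j); apply: smemD.
    by apply: coef_ideal_mono Na; apply: leq_maxl.
  by apply: coef_ideal_mono Nb; apply: leq_maxr.
have UZ c (a : A^o) : U a -> U (c *: a).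
  by move=> [i Na]; exists i; apply: smemZ.
have [u uP] := nA (Submodule U0 UD UZ).
have [M uM] : exists M, forall a, a \in u -> coef_ideal N M a.
  have : forall a, a \in u -> U a by move=> a ua; apply/uP/span_incl.
  elim: u {uP} => [|a u IH] uU; first by exists 0%N.
  have [b ub|M1 M1P] := IH; first by apply: uU; rewrite in_cons ub orbT.
  have [M2 M2P] := uU a (mem_head _ _); exists (maxn M1 M2) => b.
  rewrite in_cons => /orP[/eqP->|/M1P M1b].
    by apply: coef_ideal_mono M2P; apply: leq_maxr.
  by apply: coef_ideal_mono M1b; apply: leq_maxl.
have gens_i i : exists l : seq {poly A}, (forall p, p \in l -> N p) /\
    sub_ideal (coef_ideal N i) (coef_ideal (seq_ideal l) i).
  have [v vP] := nA (coef_ideal N i).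
  have [l [lN lv]] : exists l : seq {poly A}, (forall p, p \in l -> N p) /\
      forall a, a \in v -> coef_ideal (seq_ideal l) i a.
    have : forall a, a \in v -> coef_ideal N i a.
      by move=> a va; apply/vP/span_incl.
    elim: v {vP} => [|a v IH] vN; first by exists [::].
    have [b vb|l [lN lv]] := IH; first by apply: vN; rewrite in_cons vb orbT.
    have [p [Np sp pa]] := vN a (mem_head _ _); exists (p :: l); split.
      by move=> q; rewrite in_cons => /orP[/eqP->|/lN].
    move=> b; rewrite in_cons => /orP[/eqP->|/lv[q [lq sq qb]]].
      by exists p; split=> //; apply: span_incl; apply: mem_head.
    exists q; split=> //; apply: lq => x lx; apply: span_incl.
    by rewrite in_cons lx orbT.
  by exists l; split=> // a /vP; apply.
have [l lP] := choice gens_i.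
pose t := flatten [seq l i | i <- iota 0 M.+1].
have tN p : p \in t -> N p.
  by move=> /flattenP[_ /mapP[i _ ->]]; apply: (lP i).1.
have tNs : sub_ideal (seq_ideal t) N by move=> p; apply.
have tcoef i : (i <= M)%N -> sub_ideal (coef_ideal N i) (coef_ideal (seq_ideal t) i).
  move=> iM a /(lP i).2[p [lp sp pa]]; exists p; split=> //.
  apply: lp => q lq; apply: span_incl; apply/flattenP; exists (l i) => //.
  by apply: map_f; rewrite mem_iota.
have all_coef d : sub_ideal (coef_ideal N d) (coef_ideal (seq_ideal t) d).
  have [dM|/ltnW Md] := leqP d M; first exact: tcoef.
  move=> a Na; apply: (coef_ideal_mono Md); apply: (tcoef M) => //.
  have : U a by exists d.
  by move/uP; apply.
exists t => p; split; last exact: tNs.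
have [d] := ubnP (size p); elim: d p => [//|d IH] p; rewrite ltnS => sp Np.
case: d IH sp => [|d] IH sp.
  move: sp; rewrite leqn0 size_poly_eq0 => /eqP->; exact: smem0.
have [|q [tq sq qp]] := all_coef d p`_d; first by exists p.
apply: (@ideal_sub _ _ p q) => //; apply: IH; last first.
  by apply: smemB => //; apply: tNs.
rewrite ltnS; apply/leq_sizeP => j; rewrite leq_eqVlt => /orP[/eqP<-|dj].
  by rewrite coefB qp subrr.
rewrite coefB !nth_default ?subrr //; first exact: leq_trans sq _.
exact: leq_trans sp _.
Qed.

End Poly.

Lemma noetherian_field (k : fieldType) : noetherian k.
Proof.
move=> N; have [[c Nc c0]|N0] := pselect (exists2 c, N c & c != 0).
  exists [:: 1] => x; split=> _.
    by rewrite -[x]mulr1; apply: smemZ; apply: span_incl; apply: mem_head.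
  by rewrite -[x](divfK c0); apply: idealM.
exists [::] => x; split=> [Nx|/spans_nil->]; last exact: smem0.
suff -> : x = 0 by apply: smem0.
by apply: contrapT => /eqP x0; apply: N0; exists x.
Qed.

(** Evaluation at the last variable maps the polynomials over k[x_0, .., x_(n-1)] onto
    k[x_0, .., x_n]; a surjection is enough to carry the property over. *)
Theorem noetherian_mpoly (k : fieldType) n : noetherian {mpoly k[n]}.
Proof.
elim: n => [|n IH].
  apply: (noetherian_ring_surj (f := @mpolyC 0 k)); last exact: noetherian_field.
  move=> p; exists p@_0; apply/mpolyP => m; rewrite mcoeffC.
  have -> : m = 0%MM by apply/mnmP => -[].
  by rewrite eqxx mulr1.
pose f := GRing.RMorphism.clone _ _
  (horner_eval ('X_ord_max : {mpoly k[n.+1]}) \o map_poly (@mwiden n k)) _.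
have fE p : f p = (map_poly (@mwiden n k) p).['X_ord_max] by [].
apply: (noetherian_ring_surj (f := f)); last exact: noetherian_poly.
have f1 : exists x, f x = 1 by exists 1; rewrite rmorph1.
have fM p q : (exists x, f x = p) -> (exists x, f x = q) -> exists x, f x = p * q.
  by move=> [x <-] [y <-]; exists (x * y); rewrite rmorphM.
have fX (i : 'I_n.+1) : exists x, f x = 'X_i.
  have [j ->|->] := unliftP ord_max i; last first.
    by exists 'X; rewrite fE map_polyX hornerX.
  exists ('X_j)%:P; rewrite fE map_polyC hornerC /= mwidenX mnmwiden1.
  by congr 'X_[U_(_)]; apply/val_inj; rewrite /= /bump leqNgt ltn_ord.
move=> p; rewrite (mpolyE p).
apply: (@big_ind _ (fun p => exists x, f x = p)) => [|x y [u <-] [v <-]|m _].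
- by exists 0; rewrite rmorph0.
- by exists (u + v); rewrite rmorphD.
rewrite -mul_mpolyC; apply: (fM).
  by exists (p@_m)%:MP%:P; rewrite fE map_polyC hornerC /= mwidenC.
rewrite mpolyXE_id.
apply: (@big_ind _ (fun p => exists x, f x = p)) => [//|x y|i _]; first exact: fM.
by elim: (m i) => [|e IHe]; rewrite ?exprS ?expr0 //; apply: fM.
Qed.

End HilbertBasis.

(** * The S1-filtration *)

Section PrimaryComponents.
Variable A : comPzRingType.
Implicit Types (P Q J : ideal A).

Lemma primary_radical_prime Q P : primary_ideal Q ->
  (forall x, P x <-> in_radical Q x) -> prime_ideal P.
Proof.
move=> [Q1 Qp] PQ; split=> [/PQ[n]|x y /PQ[n]]; first by rewrite expr1n.
by rewrite exprMn => /Qp[Qx|[e Qy]]; [left | right]; apply/PQ;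
  [exists n | exists (n * e)%N; rewrite exprM].
Qed.

(* The component at a minimal prime P is the contraction of J from the
   localization at P. *)
Lemma minimal_primary_component P J Q : primary_component P J Q ->
  (forall x, P x -> in_radical J x) ->
  [/\ prime_ideal P, forall x, P x <-> in_radical Q x
    & forall x, Q x <-> exists2 g, ~ P g & J (g * x)].
Proof.
move=> [r [D [[Dprim JD _ D_inj] [i [PD QD]]]]] PJ.
have Pp := primary_radical_prime (Dprim i) PD; split=> // [x|x].
  by split=> [/PD[n /QD]|[n /QD Dx]]; [exists n | apply/PD; exists n].
have [P1 PM] := Pp.
(* If another component were contained in P, its radical would be P, since P lies in the radical of
   J; distinctness of the radicals excludes this. The value 0 at l = i is a filler, and the
   multiplier is the product of the others. *)
have sep l : exists g, l != i -> D l g /\ ~ P g.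
  have [->|li] := eqVneq l i; first by exists 0.
  apply: contrapT => no; move/eqP: li; apply; apply: D_inj => y.
  rewrite -PD; split=> [[n Dy]|/PJ[n /JD Jy]]; last by exists n.
  have : P (y ^+ n).
    by apply: contrapT => Py; apply: no; exists (y ^+ n).
  by elim: n {Dy} => [/P1//|n IH]; rewrite exprS => /PM[].
have [g gP] := choice sep.
split=> [/QD Dx|[h Ph /JD Dhx]]; last first.
  apply/QD; have [_ /(_ x h)[]//] := Dprim i; first by rewrite mulrC.
  by move=> /PD.
exists (\prod_(l < r | l != i) g l); last first.
  apply/JD => l; have [->|li] := eqVneq l i; first exact: idealM.
  by rewrite (bigD1 l) //= -mulrA; apply: idealMr; case: (gP l li).
by apply: (big_ind (fun z => ~ P z)) => // [x1 x2 Px1 Px2 /PM[]//|l /gP[]].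
Qed.

Lemma exp_idealS P n : sub_ideal (exp_ideal P n.+1) (exp_ideal P n).
Proof. by move=> x; apply=> _ [a [b [_ Pb ->]]]; apply: idealM. Qed.

Lemma exp_ideal_mul P n a b : P a -> exp_ideal P n b -> exp_ideal P n.+1 (a * b).
Proof. by move=> Pa Pb; apply: span_incl; exists a, b. Qed.

End PrimaryComponents.

Section S1Filtration.
Variables (k : fieldType) (n : nat).
Local Notation S := {mpoly k[n.+1]}.
Variables X Y Z : ideal S.

Lemma sub_saturation (J : ideal S) : sub_ideal J (saturation J).
Proof. by move=> f Jf; exists 0%N => d g _ _; apply: idealM. Qed.

(** If X contained all variables, it would contain all forms of positive degree, and saturation
    would put 1 in X. *)
Lemma prime_relevant : closed_subscheme X -> proper X -> exists i, ~ X 'X_i.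
Proof.
move=> [_ X_sat] X1; apply: contrapT => no.
have XX i : X 'X_i by apply: contrapT => Xi; apply: no; exists i.
apply/X1/X_sat; exists 1%N => d g d1 /dhomogP g_homog; rewrite mulr1.
rewrite (mpolyE g) big_seq; apply: smem_sum => mm /g_homog mmd.
rewrite -mul_mpolyC; apply: idealM.
have [i] : exists i, mm i != 0%N.
  apply: contrapT => mm0; move: d1; rewrite -mmd.
  suff -> : mm = 0%MM by rewrite mf0.
  by apply/mnmP => i; rewrite mnm0E; apply/eqP/negPn/negP => mmi; apply: mm0; exists i.
move=> mmi; have -> : mm = (U_(i) + (mm - U_(i)))%MM.
  by rewrite addmC submK // lep1mP.
by rewrite mpolyXD; apply: idealMr.
Qed.

Hypotheses (X_closed : closed_subscheme X) (Y_sub_Z : subscheme Y Z).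
Hypothesis Y_red : reduction Y X.
Variables (m : nat) (F : nat -> ideal S).
Hypothesis F_S1 : S1_filtration Z X Y m F.

(** The ideal decomposed is the saturation of Y plus the saturation of Z + X^(j+1). Some variable is
    outside X, so its powers can be absorbed into the multiplier g and both saturations vanish; Z is
    absorbed by Y. *)
Lemma S1_component j : (j <= m)%N ->
  [/\ prime_ideal X, forall f, X f <-> in_radical (F j) f
    & forall f, F j f <->
        exists2 g, ~ X g & add_ideal Y (exp_ideal X j.+1) (g * f)].
Proof.
move=> jm; have [|Xp XF FE] := minimal_primary_component (F_S1 jm).
  move=> f /Y_red[e Yf]; exists e; apply: sub_saturation.
  by apply: span_incl; left.
split=> // f; have [X1 XM] := Xp; have [i Xi] := prime_relevant X_closed X1.
have XiN N : ~ X ('X_i ^+ N).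
  by elim: N => [|N IH]; rewrite ?expr0 ?exprS // => /XM[].
have homXi N : ('X_i ^+ N : S) \is N.-homog.
  by rewrite -{2}[N]mul1n; apply: dhomogMn; rewrite dhomogX /= mdeg1.
rewrite FE; split=> -[g Xg Qg]; last first.
  exists g => //; apply: sub_saturation; apply: Qg => h [Yh|Xh].
    by apply: span_incl; left.
  apply: span_incl; right; apply: sub_saturation; apply: span_incl; by right.
(* N and N' are the degree bounds of the outer and the inner saturation, attained by powers of the
   variable. *)
have [N /(_ N _ (leqnn N) (homXi N)) /addSP[y Yy [N']]] := Qg.
move=> /(_ N' _ (leqnn N') (homXi N')) /addSP[z /Y_sub_Z Yz Xz].
exists ('X_i ^+ N' * ('X_i ^+ N * g)) => [/XM[/XiN//|/XM[/XiN//|//]]|].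
apply/addSP; exists (z + 'X_i ^+ N' * y); first by apply: smemD => //; apply: idealM.
by move: Xz; congr (smem _ _); rewrite !mulrA; ring.
Qed.

Lemma S1_prime : prime_ideal X.
Proof. by have [] := S1_component (leq0n m). Qed.

Lemma S1_sub j : (j <= m)%N -> sub_ideal (F j) X.
Proof. by move=> /S1_component[_ XF _] f Ff; apply/XF; exists 1%N. Qed.

Lemma S1_decreasing j : (j < m)%N -> sub_ideal (F j.+1) (F j).
Proof.
move=> jm f; have [_ _ FE'] := S1_component jm.
have [_ _ FE] := S1_component (ltnW jm).
move=> /FE'[g Xg /addSP[y Yy Xy]]; apply/FE; exists g => //.
by apply/addSP; exists y => //; apply: exp_idealS.
Qed.

(** The multiplier of b also serves for a b: multiplication by [a] sends Y + X^(j+1) into Y +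
    X^(j+2). *)
Lemma S1_mul j : (j < m)%N -> forall a b : S, X a -> F j b -> F j.+1 (a * b).
Proof.
move=> jm a b Xa; have [_ _ FE'] := S1_component jm.
have [_ _ FE] := S1_component (ltnW jm).
move=> /FE[g Xg /addSP[y Yy Xy]]; apply/FE'; exists g => //.
apply/addSP; exists (a * y); first exact: idealM.
rewrite mulrCA -mulrBr; exact: exp_ideal_mul.
Qed.

Lemma S1_contains j : (j <= m)%N -> sub_ideal Z (F j).
Proof.
move=> /S1_component[[X1 _] _ FE] f /Y_sub_Z Yf; apply/FE; exists 1 => //.
by rewrite mul1r; apply: span_incl; left.
Qed.

End S1Filtration.

(** * Homogeneous fractions *)

(** The finitely many generators can be taken in P itself, since each element of the span involves
    only finitely many members of P. This keeps them homogeneous later. *)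
Lemma noetherian_span (A : comPzRingType) (P : A -> Prop) : noetherian A ->
  exists l : seq A, (forall b, b \in l -> P b) /\
    forall a, P a -> seq_ideal l a.
Proof.
move=> nA; have [s sP] := nA (span (P : A^o -> Prop)).
have fin x : span (P : A^o -> Prop) x -> exists l : seq A,
    (forall b, b \in l -> P b) /\ seq_ideal l x.
  pose Q := fun x : A^o => exists l : seq A,
    (forall b, b \in l -> P b) /\ seq_ideal l x.
  have Q0 : Q 0 by exists [::]; split=> //; apply: smem0.
  have QD u v : Q u -> Q v -> Q (u + v).
    move=> [l [lP lu]] [l' [lP' lv]]; exists (l ++ l'); split.
      by move=> b; rewrite mem_cat => /orP[/lP|/lP'].
    by apply: smemD; [apply: spans_subset lu | apply: spans_subset lv] => z;
      rewrite mem_cat => ->; rewrite ?orbT.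
  have QZ c (u : A^o) : Q u -> Q (c *: u).
    by move=> [l [lP lu]]; exists l; split=> //; apply: smemZ.
  move/(_ (Submodule Q0 QD QZ)); apply=> y Py; exists [:: y]; split.
    by move=> b; rewrite mem_seq1 => /eqP->.
  by apply: span_incl; apply: mem_head.
have [l [lP ls]] : exists l : seq A, (forall b, b \in l -> P b) /\
    forall x, x \in s -> seq_ideal l x.
  have : forall x, x \in s -> span (P : A^o -> Prop) x.
    by move=> x sx; apply/sP/span_incl.
  elim: s {sP} => [|y s IH] sP; first by exists [::].
  have [x sx|l [lP ls]] := IH; first by apply: sP; rewrite in_cons sx orbT.
  have [l' [lP' ly]] := fin y (sP y (mem_head _ _)).
  exists (l' ++ l); split=> [b|x]; first by rewrite mem_cat => /orP[/lP'|/lP].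
  rewrite in_cons => /orP[/eqP->|/ls lx].
    by apply: spans_subset ly => z; rewrite mem_cat => ->.
  by apply: spans_subset lx => z; rewrite mem_cat orbC => ->.
exists l; split=> // a Pa.
have /sP : span (P : A^o -> Prop) a by apply: span_incl.
by apply.
Qed.

Section HomogeneousGenerators.
Variables (k : fieldType) (n : nat).
Local Notation S := {mpoly k[n.+1]}.

Lemma pihomogM d e (c b : S) : b \is e.-homog ->
  pihomog mdeg d (c * b) = if (e <= d)%N then pihomog mdeg (d - e) c * b else 0.
Proof.
move=> hb; pose N := maxn (mmeasure mdeg c) d.+1.
rewrite {1}(@pihomog_partitionE _ _ mdeg N c (leq_maxl _ _)) mulr_suml raddf_sum /=.
have term i : pihomog mdeg d (pihomog mdeg i c * b) =
    if (i + e == d)%N then pihomog mdeg i c * b else 0.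
  have hM := dhomogM (pihomogP mdeg i c) hb.
  by case: eqP => [<-|/eqP ne]; [rewrite pihomog_dE | rewrite (pihomog_ne0 ne hM)].
under eq_bigr do rewrite term.
case: leqP => [ed|de].
  have dN : (d - e < N)%N.
    by apply: leq_ltn_trans (leq_subr _ _) _; rewrite leq_max ltnSn orbT.
  rewrite (bigD1 (Ordinal dN)) //= subnK // eqxx big1 ?addr0 // => i ne.
  rewrite ifN //; apply: contra ne => /eqP ie; apply/eqP/val_inj => /=.
  by rewrite -ie addnK.
rewrite big1 // => i _; rewrite ifN //; apply: contraTneq de => <-.
by rewrite -leqNgt leq_addl.
Qed.

(** The last clause is made for fractions of degree zero: if t_i has the degree of b_i, then a / t
    is the sum of the (c_i t_i / t) (b_i / t_i), all of degree zero. *)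
Lemma homogeneous_generators (P : nat -> S -> Prop) :
  (forall d b, P d b -> b \is d.-homog) ->
  exists r (b : 'I_r -> S) (e : 'I_r -> nat), (forall i, P (e i) (b i)) /\
    forall d a, P d a -> exists c : 'I_r -> S, a = \sum_i c i * b i /\
      forall i (t : S), t \is (e i).-homog -> c i * t \is d.-homog.
Proof.
move=> P_homog.
have [l [lP lgen]] :=
  noetherian_span (fun b => exists d, P d b) (@noetherian_mpoly k n.+1).
have lh (i : 'I_(size l)) : exists e, P e l`_i by apply/lP/mem_nth.
have [e eP] := choice lh.
exists (size l), (fun i => l`_i), e; split=> // d a Pa.
have ha := P_homog _ _ Pa.
have [c ac] := spans_sum (lgen a (ex_intro _ d Pa)).
exists (fun i => if (e i <= d)%N then pihomog mdeg (d - e i) (c i) else 0).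
split=> [|i t ht]; last first.
  case: leqP => [ed|_]; last by rewrite mul0r dhomog0.
  by have := dhomogM (pihomogP mdeg (d - e i) (c i)) ht; rewrite subnK.
rewrite -[LHS](pihomog_dE ha) {1}ac raddf_sum /=; apply: eq_bigr => i _.
rewrite [_ *: _](_ : _ = c i * l`_i) // (pihomogM _ _ (P_homog _ _ (eP i))).
by case: leqP; rewrite ?mul0r.
Qed.

End HomogeneousGenerators.

Section FieldIdentities.
Variable F : fieldType.
Implicit Types a b c d t : F.

Lemma fracM_cancel a b c t : t != 0 -> t * b / c * (a / t) = a * b / c.
Proof.
move=> t0; rewrite [t * b]mulrC -!mulrA [_^-1 * (a / t)]mulrCA.
by rewrite [t * _]mulrCA [t * _]mulrCA divff // mulr1 mulrCA.
Qed.

Lemma frac_expand a b t : t != 0 -> a / b = (a * t) / (b * t).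
Proof. by move=> t0; rewrite invfM mulrACA divff // mulr1. Qed.

Lemma frac_split a b c t : t != 0 -> c * b / a = c * t / a * (b / t).
Proof. by move=> t0; rewrite [c * t]mulrC fracM_cancel // [c * b]mulrC. Qed.

Lemma frac_cross a b c t : b != 0 -> t != 0 -> a / b = c / t -> a * t = b * c.
Proof. by move=> b0 t0 /eqP; rewrite eqr_div // => /eqP->; rewrite mulrC. Qed.

End FieldIdentities.

Section HomogeneousFractions.
Variables (k : fieldType) (n : nat).
Local Notation S := {mpoly k[n.+1]}.
Implicit Types (T : mulset k n) (I J : ideal S) (x y z : {fraction S}).
Local Notation "T `_0" := (hfrac T (fun=> True)) (at level 2, format "T `_0").

Lemma frac_neq0 x y : x != 0 -> y != 0 -> x * y != 0.
Proof. exact: (@mulf_neq0 {fraction S}). Qed.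

Lemma hfrac_mono T (P Q : S -> Prop) x : (forall a, P a -> Q a) ->
  hfrac T P x -> hfrac T Q x.
Proof. by move=> PQ [d [a [t [/PQ Qa ha ht Tt ->]]]]; exists d, a, t. Qed.

Lemma hfrac_full T J x : hfrac T J x -> T`_0 x.
Proof. exact: hfrac_mono. Qed.

Lemma hfrac_top T x : T`_0 x -> hfrac T (fullI : ideal S) x.
Proof. exact: hfrac_mono. Qed.

Lemma hfrac_mulT T x y : T`_0 x -> T`_0 y -> T`_0 (x * y).
Proof. by move=> Tx /hfrac_top Ty; apply: hfrac_full (hfracM Tx Ty). Qed.

Lemma hfrac1 T : T`_0 1.
Proof.
exists 0%N, 1, 1; rewrite ?dhomog1 ?oner_eq0 ?tofrac1 ?divr1; split=> //.
by split=> //; apply: mulset1.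
Qed.

Lemma hfrac_sum T J r (x : 'I_r -> {fraction S}) :
  (forall i, hfrac T J (x i)) -> hfrac T J (\sum_i x i).
Proof.
by move=> Jx; elim/big_ind: _ => //; [apply: hfrac0 | move=> *; apply: hfracD].
Qed.

Lemma mulsetX T (t : S) e : T t -> T (t ^+ e).
Proof.
by move=> Tt; elim: e => [|e IH]; [apply: mulset1 | rewrite exprS; apply: mulsetM].
Qed.

Lemma powers_sub (p : point k n) (f : S) e : ~ p f -> ~ p (f ^+ e).
Proof. exact: (@mulsetX (complement p)). Qed.

Lemma point_neq0 (p : point k n) (f : S) : ~ p f -> f != 0.
Proof. by move=> pf; apply: contra_notN pf => /eqP->; apply: smem0. Qed.

Section Localization.
Variables (p : point k n) (f : S) (delta : nat).
Hypotheses (pf : ~ p f) (delta_gt0 : (0 < delta)%N) (hf : f \is delta.-homog).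
Local Notation Tf := (powers f).
Local Notation Tp := (complement p).

Lemma hfrac_localize (J : S -> Prop) x : hfrac Tf J x -> hfrac Tp J x.
Proof.
move=> [d [a [t [Ja ha ht [[e et] t0] ->]]]]; exists d, a, t; split=> //.
by split=> //; rewrite et; apply: powers_sub.
Qed.

(** Sections over D_+(f) that are invertible at p. The stalk at p is obtained from the sections over
    D_+(f) by inverting these. *)
Definition loc_unit (u : {fraction S}) : Prop := [/\ u != 0, Tf`_0 u & Tp`_0 u^-1].

Lemma loc_unitM u v : loc_unit u -> loc_unit v -> loc_unit (u * v).
Proof.
move=> [u0 Tu Tu'] [v0 Tv Tv']; split; first exact (frac_neq0 u0 v0).
  exact: hfrac_mulT.
by rewrite invfM; apply: hfrac_mulT.
Qed.

Lemma loc_unit1 : loc_unit 1.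
Proof. by split; rewrite ?oner_eq0 ?invr1 //; apply: hfrac1. Qed.

Lemma hfrac_clear_denominator J x : hfrac Tp J x ->
  exists2 u, loc_unit u & hfrac Tf J (u * x).
Proof.
move=> [d [a [t [Ja ha ht [Tt t0] ->]]]].
have f0 := point_neq0 pf.
have htd : t ^+ delta \is (d * delta).-homog by apply: dhomogMn.
have hfd : f ^+ d \is (d * delta).-homog by rewrite mulnC; apply: dhomogMn.
have T0 : tofrac t != 0 by rewrite tofrac_eq0.
(* With t of degree d and f of degree [delta], both t^delta and f^d have degree d delta; as [delta]
   is positive, t^delta cancels the denominator t. *)
exists (tofrac (t ^+ delta) / tofrac (f ^+ d)).
  split.
  - by apply: frac_neq0; rewrite ?invr_eq0 tofrac_eq0; apply: expf_neq0.
  - exists (d * delta)%N, (t ^+ delta), (f ^+ d); split=> //.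
    by split; [exists d | rewrite expf_neq0].
  - exists (d * delta)%N, (f ^+ d), (t ^+ delta); split=> //.
      by split; [apply: (@mulsetX Tp) | rewrite expf_neq0].
    by rewrite invfM invrK mulrC.
exists (d * delta)%N, (a * t ^+ delta.-1), (f ^+ d); split=> //.
- exact: idealMr.
- by rewrite -(prednK delta_gt0) mulnS; apply: dhomogM => //; apply: dhomogMn.
- by split; [exists d | rewrite expf_neq0].
rewrite -{1}(prednK delta_gt0) exprS !tofracM.
exact (@fracM_cancel {fraction S} _ _ _ _ T0).
Qed.

Lemma hfrac_clear_denominators r (x : 'I_r -> {fraction S}) :
  (forall i, Tp`_0 (x i)) ->
  exists2 u, loc_unit u & forall i, Tf`_0 (u * x i).
Proof.
elim: r x => [|r IH] x Tx; first by exists 1; [apply: loc_unit1 | case].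
have [u u_unit Tux] := IH (fun i => x (lift ord0 i)) (fun i => Tx _).
have [v v_unit Tvx] := hfrac_clear_denominator (hfrac_top (Tx ord0)).
exists (u * v) => [|i]; first exact: loc_unitM.
have [_ Tu _] := u_unit; have [_ Tv _] := v_unit.
have [j ->|->] := unliftP ord0 i.
  by rewrite [u * v]mulrC -mulrA; apply: hfrac_mulT.
by rewrite -mulrA; apply: hfrac_mulT => //; apply: hfrac_full Tvx.
Qed.

End Localization.

(* Freeness of J_T / J'_T over (S / X)_T, expressed in the fraction field. *)
Definition hfree T (X J J' : ideal S) : Prop :=
  exists r (e : 'I_r -> {fraction S}),
  [/\ forall i, hfrac T J (e i),
      forall z, hfrac T J z -> exists2 c : 'I_r -> {fraction S},
        forall i, T`_0 (c i) & hfrac T J' (z - \sum_i c i * e i)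
    & forall c : 'I_r -> {fraction S}, (forall i, T`_0 (c i)) ->
        hfrac T J' (\sum_i c i * e i) -> forall i, hfrac T X (c i)].

Lemma hfree_localize (p : point k n) (f : S) (X J J' : ideal S) :
  affine_nbhd p f -> hfree (powers f) X J J' -> hfree (complement p) X J J'.
Proof.
move=> [pf [d d0 hf]] [r [e [Je e_gen e_free]]]; exists r, e; split=> [i|z Jz|c Tc Jc i].
- exact (hfrac_localize pf (Je i)).
- have [u [u0 _ Tu'] Juz] := hfrac_clear_denominator pf d0 hf Jz.
  have [c Tc Jc] := e_gen _ Juz; exists (fun i => u^-1 * c i).
    by move=> i; apply: hfrac_mulT => //; exact (hfrac_localize pf (Tc i)).
  have -> : z - \sum_i u^-1 * c i * e i = u^-1 * (u * z - \sum_i c i * e i).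
    rewrite mulrBr mulKf // mulr_sumr; congr (_ - _).
    by apply: eq_bigr => i _; rewrite mulrA.
  by apply: hfracM => //; exact (hfrac_localize pf Jc).
have [u u_unit Tuc] := hfrac_clear_denominators pf d0 hf Tc.
have [v v_unit Jvc] := hfrac_clear_denominator pf d0 hf Jc.
have [u0 Tu Tu'] := u_unit; have [v0 Tv Tv'] := v_unit.
have [uv0 Tuv Tuv'] := loc_unitM u_unit v_unit.
rewrite -(mulKf uv0 (c i)); apply: hfracM Tuv' _; apply: (hfrac_localize pf).
refine (e_free (fun i => u * v * c i) _ _ i) => [j|].
  by rewrite [u * v]mulrC -mulrA; apply: hfrac_mulT.
under eq_bigr do rewrite -mulrA.
by rewrite -mulr_sumr -mulrA; apply: hfracM.
Qed.

Lemma hfrac_enlarge (f h : S) (J : ideal S) x e : h \is e.-homog -> h != 0 ->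
  hfrac (powers f) J x -> hfrac (powers (f * h)) J x.
Proof.
move=> hh h0 [d [a [t [Ja ha ht [[i ti] t0] ->]]]].
exists (d + e * i)%N, (a * h ^+ i), (t * h ^+ i); split.
- exact: idealMr.
- by apply: dhomogM => //; apply: dhomogMn.
- by apply: dhomogM => //; apply: dhomogMn.
- by split; [exists i; rewrite ti exprMn | rewrite mulf_neq0 ?expf_neq0].
- rewrite !tofracM; apply: (@frac_expand {fraction S}).
  by rewrite tofrac_eq0; apply: expf_neq0.
Qed.

Lemma hfrac_spread (p : point k n) J x : hfrac (complement p) J x ->
  exists t, [/\ ~ p t, exists d, t \is d.-homog & hfrac (powers t) J x].
Proof.
move=> [d [a [t [Ja ha ht [Tt t0] ->]]]]; exists t; split=> //; first by exists d.
by exists d, a, t; split=> //; split=> //; exists 1%N.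
Qed.

Lemma hfrac_spread_all (p : point k n) J r (x : 'I_r -> {fraction S}) :
  (forall i, hfrac (complement p) J (x i)) ->
  exists t, [/\ ~ p t, exists d, t \is d.-homog
    & forall i, hfrac (powers t) J (x i)].
Proof.
elim: r x => [|r IH] x Jx.
  exists 1; split; [exact: compl1 | by exists 0%N; apply: dhomog1 | by case].
have [t [pt [d ht] Jt]] := IH (fun i => x (lift ord0 i)) (fun i => Jx _).
have [s [ps [e hs] Js]] := hfrac_spread (Jx ord0).
exists (t * s); split; first exact: complM.
  by exists (d + e)%N; apply: dhomogM.
move=> i; have [j ->|->] := unliftP ord0 i.
  by apply: hfrac_enlarge hs (point_neq0 ps) (Jt j).
by rewrite mulrC; apply: hfrac_enlarge ht (point_neq0 pt) Js.
Qed.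

(** If a / t = b / u with b in X, then a u = t b is in X while u is not, as X <= p; so a is in X.
    Here the integrality of X enters. *)
Lemma hfrac_contract (p : point k n) (f : S) (X : ideal S) x :
  prime_ideal X -> sub_ideal X p ->
  (powers f)`_0 x -> hfrac (complement p) X x -> hfrac (powers f) X x.
Proof.
move=> [_ XM] Xp [d [a [t [_ ha ht [Tt t0] ->]]]] [e [b [u [Xb hb hu [pu u0] E]]]].
exists d, a, t; split=> //.
have /XM[] // : X (a * u); last by move/Xp.
suff -> : a * u = t * b by apply: idealM.
apply/eqP; rewrite -tofrac_eq !tofracM; apply/eqP.
rewrite -tofrac_eq0 in t0; rewrite -tofrac_eq0 in u0.
exact (@frac_cross {fraction S} _ _ _ _ t0 u0 E).
Qed.

(** Generation amounts to finitely many conditions, one for each homogeneous generator of J, and so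
    holds near p. Independence needs no shrinking: a relation over D_+(h) has coefficients in X at
    p, hence in X over D_+(h) by [hfrac_contract]. *)
Lemma hfree_spread (p : point k n) (X J J' : ideal S) :
  prime_ideal X -> sub_ideal X p -> hfree (complement p) X J J' ->
  exists2 f, affine_nbhd p f & hfree (powers f) X J J'.
Proof.
move=> Xprime Xp [r [e [Je e_gen e_free]]].
have [l pl] := point_relevant p.
have hl i : ('X_l ^+ i : S) \is i.-homog.
  by rewrite -{2}[i]mul1n; apply: dhomogMn; rewrite dhomogX /= mdeg1.
have [|s [b [d [bP b_gen]]]] :=
  @homogeneous_generators k n (fun d a => J a /\ a \is d.-homog).
  by move=> d a [].
(* The generators are brought to degree zero by powers of a variable outside p. *)
pose beta i := tofrac (b i) / tofrac ('X_l ^+ d i).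
have Jbeta i : hfrac (complement p) J (beta i).
  have [Jb hb] := bP i; exists (d i), (b i), ('X_l ^+ d i); split=> //.
  by split; [apply: powers_sub | rewrite expf_neq0 ?(point_neq0 pl)].
have /choice[c cP] : forall i, exists c : 'I_r -> {fraction S},
    (forall j, (complement p)`_0 (c j)) /\
    hfrac (complement p) J' (beta i - \sum_j c j * e j).
  by move=> i; have [c] := e_gen _ (Jbeta i); exists c.
have [t1 [pt1 [d1 ht1] Jt1]] := hfrac_spread_all Je.
have [t2 [pt2 [d2 ht2] Jt2]] := hfrac_spread_all (fun i => (cP i).2).
have [t3 [pt3 [d3 ht3] Jt3]] := hfrac_spread_all
  (fun i : 'I_#|{: 'I_s * 'I_r}| =>
     hfrac_top ((cP (enum_val i).1).1 (enum_val i).2)).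
(* [t1], [t2], [t3] are denominators for the basis, for the errors in J' and for the coefficients;
   the factor ['X_l] makes the degree of h positive. *)
pose h := 'X_l * t1 * t2 * t3.
exists h.
  split; first by do !apply: complM.
  exists (1 + d1 + d2 + d3)%N; first by rewrite !addSn.
  by do !apply: dhomogM => //; rewrite -['X_l]expr1; apply: hl.
have n0 := point_neq0.
have Jh1 i : hfrac (powers h) J (e i).
  have := Jt1 i => /(hfrac_enlarge (hl 1%N) (n0 p _ (powers_sub pl))).
  move=> /(hfrac_enlarge ht2 (n0 p _ pt2)) /(hfrac_enlarge ht3 (n0 p _ pt3)).
  by rewrite expr1 [t1 * _]mulrC.
have Jh2 i : hfrac (powers h) J' (beta i - \sum_j c i j * e j).
  have := Jt2 i => /(hfrac_enlarge (hl 1%N) (n0 p _ (powers_sub pl))).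
  move=> /(hfrac_enlarge ht1 (n0 p _ pt1)) /(hfrac_enlarge ht3 (n0 p _ pt3)).
  by rewrite expr1; congr (hfrac (powers _) _ _); rewrite /h; ring.
have Jh3 i j : (powers h)`_0 (c i j).
  apply: (@hfrac_full _ fullI).
  have := Jt3 (enum_rank (i, j)); rewrite enum_rankK.
  move=> /(hfrac_enlarge (hl 1%N) (n0 p _ (powers_sub pl))).
  move=> /(hfrac_enlarge ht1 (n0 p _ pt1)) /(hfrac_enlarge ht2 (n0 p _ pt2)).
  by rewrite expr1; congr (hfrac (powers _) _ _); rewrite /h; ring.
have ph : ~ p h by do !apply: complM.
exists r, e; split=> // [z [D [a [t [Ja ha ht [Tt t0] ->]]]]|g Tg Jg i]; last first.
  apply: (hfrac_contract Xprime Xp (Tg i)); apply: e_free => [j|].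
    exact (hfrac_localize ph (Tg j)).
  exact (hfrac_localize ph Jg).
have [g [ag hg]] := b_gen D a (conj Ja ha).
pose gamma i := tofrac (g i * 'X_l ^+ d i) / tofrac t.
have Tgamma i : (powers h)`_0 (gamma i).
  by exists D, (g i * 'X_l ^+ d i), t; split=> //; apply: hg.
exists (fun j => \sum_i gamma i * c i j).
  move=> j; apply: (@hfrac_full _ fullI); apply: hfrac_sum => i.
  by apply: hfrac_top; apply: hfrac_mulT.
have -> : tofrac a / tofrac t - \sum_j (\sum_i gamma i * c i j) * e j =
    \sum_i gamma i * (beta i - \sum_j c i j * e j).
  under [RHS]eq_bigr do rewrite mulrBr.
  rewrite sumrB; congr (_ - _).
    rewrite ag rmorph_sum mulr_suml; apply: eq_bigr => i _.
    rewrite /gamma /beta /= !tofracM; apply: (@frac_split {fraction S}).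
    by rewrite tofrac_eq0; apply: expf_neq0; apply: n0 pl.
  under eq_bigr do rewrite mulr_suml.
  rewrite exchange_big /=; apply: eq_bigr => i _; rewrite mulr_sumr.
  by apply: eq_bigr => j _; rewrite mulrA.
by apply: hfrac_sum => i; apply: hfracM.
Qed.

End HomogeneousFractions.

(** * Stalks and the modules L_j *)

Section LQuotient.
Variables (R : comPzRingType) (Z I J J' : ideal R).
Hypotheses (ZI : sub_ideal Z I) (ZJ' : sub_ideal Z J') (J'J : sub_ideal J' J).
Hypothesis IJ : forall a b : R, I a -> J b -> J' (a * b).
Local Notation q := (to_quot Z).
Local Notation QI := (quot_ideal Z I).
Local Notation QJ := (quot_ideal Z J).
Local Notation QJ' := (quot_ideal Z J').
Local Notation image := (mod_image QI (trace QJ QJ')).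
Local Notation L := (quot_mod image).
Local Notation rho c := (to_quot QI (q c)).

Definition Lclass (y : sub_mod QJ) : L := \pi_(quot_mod image) (to_mod QI y).

Lemma Lclass_surj (l : L) : exists y, l = Lclass y.
Proof.
have [y ey] := to_modP (repr l : mod_ideal QI (sub_mod QJ)); exists y.
by rewrite /Lclass -ey reprK.
Qed.

Lemma LclassD x y : Lclass (x + y) = Lclass x + Lclass y.
Proof. by rewrite /Lclass to_modD -quot_piD. Qed.

Lemma LclassZ (a : quot_ring Z) y : to_quot QI a *: Lclass y = Lclass (a *: y).
Proof.
rewrite /Lclass -to_modZ.
exact: (@quot_piZ _ _ image (to_quot QI a) (to_mod QI y)).
Qed.

(** As I J <= J', dividing by I J is absorbed in the division by J', and L is J / J'. *)
Lemma smul_trace y : smul QI (sub_mod QJ) y -> QJ' (sub_val y).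
Proof.
move/(_ (trace QJ QJ')); apply=> _ [a [x [[c Ic ->] ->]]] /=.
have /smem_predP[b Jb eb] := sub_valP x.
exists (c * b); first exact: IJ.
by rewrite /trace_mem /= to_quotMr -eb.
Qed.

Lemma Lclass_eq x y : Lclass x = Lclass y <-> QJ' (sub_val x - sub_val y).
Proof.
rewrite /Lclass quot_eqP; split=> [[z Nz]|Nxy].
  have -> : to_mod QI x - to_mod QI y = to_mod QI (x - y).
    by apply: (addIr (to_mod QI y)); rewrite -to_modD !subrK.
  move/to_mod_eqP/smul_trace => Nxyz.
  exact (smem_sub Nxyz Nz).
exists (x - y) => //.
by apply: (addIr (to_mod QI y)); rewrite -to_modD !subrK.
Qed.

(** A relation in place of the map J -> L, which passes through R / Z, a subtype and two module
    quotients; [represents_eq] says that its kernel is J'. *)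
Definition represents (z : R) (l : L) : Prop :=
  exists2 y : sub_mod QJ, sub_val y = q z & l = Lclass y.

Lemma represents_mem z l : represents z l -> J z.
Proof.
move=> [y yz _]; have /smem_predP := sub_valP y; rewrite yz => /pre_quot_ideal.
by apply=> x /ZJ' /J'J.
Qed.

Lemma represented z : J z -> exists l, represents z l.
Proof.
move=> Jz; have qz : q z \in smem_pred QJ by apply/smem_predP; exists z.
by exists (Lclass (SubMod qz)), (SubMod qz).
Qed.

Lemma representative l : exists z, represents z l.
Proof.
have [y ->] := Lclass_surj l; have [z yz] := to_quotP (sub_val y).
by exists z, y.
Qed.

Lemma representsD z w l l' :
  represents z l -> represents w l' -> represents (z + w) (l + l').
Proof.
move=> [y yz ->] [x xw ->]; exists (y + x); last by rewrite LclassD.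
by rewrite to_quotD -yz -xw.
Qed.

Lemma representsZ c z l : represents z l -> represents (c * z) (rho c *: l).
Proof.
move=> [y yz ->]; exists (q c *: y); last by rewrite LclassZ.
by rewrite to_quotMr -yz.
Qed.

Lemma represents0 : represents 0 0.
Proof.
exists 0; first by rewrite to_quot0.
by apply: (addrI (Lclass 0)); rewrite -LclassD !addr0.
Qed.

Lemma represents_eq z w l l' : represents z l -> represents w l' ->
  l = l' <-> J' (z - w).
Proof.
move=> [y yz ->] [x xw ->]; rewrite Lclass_eq yz xw -to_quotB.
exact: pre_quot_ideal.
Qed.

Lemma represents_comb r (z c : 'I_r -> R) (l : 'I_r -> L) :
  (forall i, represents (z i) (l i)) ->
  represents (\sum_i c i * z i) (\sum_i rho (c i) *: l i).
Proof.
move=> zl; apply: (big_ind2 represents).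
- exact: represents0.
- by move=> *; apply: representsD.
- by move=> i _; apply: representsZ.
Qed.

Lemma rho_eq c d : rho c = rho d <-> I (c - d).
Proof. by rewrite to_quot_eqP -to_quotB pre_quot_ideal. Qed.

Lemma rho_surj r (v : 'rV[quot_ring QI]_r) :
  exists c : 'I_r -> R, forall i, v 0 i = rho (c i).
Proof.
have lift i : exists c : R, v 0 i = rho c.
  by have [a ->] := to_quotP (v 0 i); have [c ->] := to_quotP a; exists c.
by have [c cP] := choice lift; exists c.
Qed.

Lemma represents_row r (z c : 'I_r -> R) (l : 'I_r -> L) (v : 'rV_r) :
  (forall i, represents (z i) (l i)) -> (forall i, v 0 i = rho (c i)) ->
  represents (\sum_i c i * z i) (\sum_i v 0 i *: l i).
Proof.
move=> zl vc; rewrite (eq_bigr (fun i => rho (c i) *: l i)).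
  exact: represents_comb.
by move=> i _; rewrite vc.
Qed.

Lemma free_LquotP : free L <-> free_over I J J'.
Proof.
split=> [[r [e f_bij]]|[r [z [Jz z_gen z_free]]]].
  have [z ze] := choice (fun i => representative (e i)).
  exists r, z; split=> [i|w Jw|c Jc i].
  - exact: represents_mem (ze i).
  - have [l wl] := represented Jw; have [f' fK f'K] := f_bij.
    have [c cP] := rho_surj (f' l); exists c.
    exact/(represents_eq wl (represents_row ze cP)).
  have c_row j : (\row_i rho (c i)) 0 j = rho (c j) by rewrite mxE.
  have z_row j : (\row_(i < r) rho 0) 0 j = rho 0 by rewrite mxE.
  have /(bij_inj f_bij)/rowP/(_ i) : \sum_i (\row_i rho (c i)) 0 i *: e i =
      \sum_i (\row_(i < r) rho 0) 0 i *: e i.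
    apply/(represents_eq (represents_row ze c_row) (represents_row ze z_row)).
    by rewrite [X in _ - X]big1 ?subr0 // => j _; rewrite mul0r.
  by rewrite !mxE -[c i]subr0 => /rho_eq; rewrite !subr0.
have [l zl] := choice (fun i => represented (Jz i)).
exists r, l; pose f (v : 'rV[quot_ring QI]_r) := \sum_i v 0 i *: l i.
have fE (v : 'rV[quot_ring QI]_r) (c : 'I_r -> R) :
    (forall i, v 0 i = rho (c i)) -> represents (\sum_i c i * z i) (f v).
  exact: represents_row.
have f_inj : injective f.
  move=> v w; have [[c vc] [d wd]] := (rho_surj v, rho_surj w).
  move/(represents_eq (fE _ _ vc) (fE _ _ wd)); rewrite -sumrB => Jcd.
  apply/rowP => i; rewrite vc wd; apply/rho_eq.
  apply: (z_free (fun i => c i - d i)).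
  by under eq_bigr do rewrite mulrBl.
have f_surj u : exists v, f v = u.
  have [w wu] := representative u; have [c wc] := z_gen w (represents_mem wu).
  exists (\row_i rho (c i)).
  have vc i : (\row_i rho (c i)) 0 i = rho (c i) by rewrite mxE.
  by apply/esym/(represents_eq wu (fE _ _ vc)).
have [g gP] := choice f_surj.
by exists g => [v|u]; rewrite -/(f _) ?gP //; apply: f_inj; rewrite gP.
Qed.

End LQuotient.

(** * Degree-zero localizations: noetherianity, stalks and sections of L_j *)

Section HomogeneousLocalRings.
Variables (k : fieldType) (n : nat).
Local Notation S := {mpoly k[n.+1]}.
Implicit Types (T : mulset k n) (I J W X Z : ideal S) (p : point k n).

Lemma hloc_exists T x : hfrac T (fun=> True) x -> exists y : hloc T, hloc_val y = x.
Proof. by move=> Tx; exists (Hloc (asboolT Tx : x \in hloc_pred T)). Qed.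

Lemma hloc_val_full T (y : hloc T) : hfrac T (fun=> True) (hloc_val y).
Proof. exact/asboolP/(hloc_valP y). Qed.

Lemma hloc_valM T (x y : hloc T) : hloc_val (x * y) = hloc_val x * hloc_val y.
Proof. by []. Qed.

Lemma hloc_valB T (x y : hloc T) : hloc_val (x - y) = hloc_val x - hloc_val y.
Proof. by []. Qed.

Lemma hloc_val_comb T r (c e : 'I_r -> hloc T) :
  hloc_val (\sum_i c i * e i) = \sum_i hloc_val (c i) * hloc_val (e i).
Proof. exact: (big_morph (@hloc_val k n T) (fun _ _ => erefl) (erefl _)). Qed.

Lemma hloc_inj T (x y : hloc T) : hloc_val x = hloc_val y -> x = y.
Proof. exact: val_inj. Qed.

(** [homogeneous_generators] is applied to the numerators of members of N, each kept with its
    fraction and denominator. The coefficient c_i s_i / t of the i-th fraction, with denominator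
    s_i, then has degree zero. *)
Lemma noetherian_hloc T : noetherian (hloc T).
Proof.
move=> N.
pose P d a := exists y : hloc T * S, [/\ N y.1, a \is d.-homog,
  y.2 \is d.-homog, T y.2 /\ y.2 != 0 & hloc_val y.1 = tofrac a / tofrac y.2].
have [|r [b [e [bP b_gen]]]] := @homogeneous_generators k n P.
  by move=> d a [y []].
have [yt ytP] := choice bP.
exists [seq (yt i).1 | i <- enum 'I_r] => x; split=> [Nx|]; last first.
  by apply=> _ /mapP[i _ ->]; have [] := ytP i.
have [d [a [t [_ ha ht [Tt t0] ex]]]] := hloc_val_full x.
have [|c [ac hc]] := b_gen d a; first by exists (x, t).
have : forall i, exists g : hloc T,
    hloc_val g = tofrac (c i * (yt i).2) / tofrac t.
  move=> i; apply: hloc_exists; exists d, (c i * (yt i).2), t; split=> //.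
  by apply: hc; have [] := ytP i.
move=> /choice[g gP].
have -> : x = \sum_i g i * (yt i).1.
  apply: hloc_inj; rewrite ex hloc_val_comb ac rmorph_sum mulr_suml.
  apply: eq_bigr => i _; have [_ _ _ [_ s0] ->] := ytP i.
  rewrite gP /= !tofracM; apply: (@frac_split {fraction S}).
  by rewrite tofrac_eq0.
apply: smem_sum => i _; apply: idealM; apply: span_incl.
by apply/mapP; exists i => //; rewrite mem_enum.
Qed.

Lemma loc_ideal_sub T I J : sub_ideal I J ->
  sub_ideal (loc_ideal T I) (loc_ideal T J).
Proof. by move=> IJ x; apply: hfrac_mono. Qed.

Lemma loc_ideal_mul T I J J' : (forall a b : S, I a -> J b -> J' (a * b)) ->
  forall x y : hloc T,
    loc_ideal T I x -> loc_ideal T J y -> loc_ideal T J' (x * y).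
Proof.
move=> IJ x y [d [a [t [Ia ha ht [Tt t0] ex]]]] [e [b [s [Jb hb hs [Ts s0] ey]]]].
exists (d + e)%N, (a * b), (t * s); split.
- exact: IJ.
- exact: dhomogM.
- exact: dhomogM.
- by rewrite mulf_neq0 //; split=> //; apply: mulsetM.
- by rewrite hloc_valM ex ey !tofracM mulf_div.
Qed.

Lemma loc_ideal_nil T I J : (forall a : S, I a -> exists e, J (a ^+ e)) ->
  forall x : hloc T, loc_ideal T I x -> exists e, loc_ideal T J (x ^+ e).
Proof.
move=> nil x [d [a [t [/nil[e Ja] ha ht [Tt t0] ex]]]]; exists e.
exists (d * e)%N, (a ^+ e), (t ^+ e); split=> //.
- exact: dhomogMn.
- exact: dhomogMn.
- by rewrite expf_neq0 //; split=> //; apply: mulsetX.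
rewrite !rmorphXn -expr_div_n -ex.
by elim: (e) => [//|i IH]; rewrite !exprS -IH.
Qed.

Section Stalk.
Variable p : point k n.
Local Notation Tp := (complement p).

Lemma loc_point_proper : proper (loc_ideal Tp p).
Proof.
move=> [d [a [t [pa _ _ [pt t0] e]]]]; apply: pt.
suff -> : t = a by [].
apply/eqP; rewrite -tofrac_eq; apply/eqP.
rewrite -tofrac_eq0 in t0.
rewrite -[RHS](@divfK {fraction S} _ t0) -e; exact/esym/mul1r.
Qed.

Lemma loc_point_local (x : hloc Tp) : ~ loc_ideal Tp p x ->
  exists y : hloc Tp, y * x = 1.
Proof.
move=> px; have [d [a [t [_ ha ht [pt t0] ex]]]] := hloc_val_full x.
have pa : ~ p a by move=> pa; apply: px; exists d, a, t.
have a0 := point_neq0 pa.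
have [|y ey] := @hloc_exists Tp (tofrac t / tofrac a).
  by exists d, t, a.
exists y; apply: hloc_inj; rewrite hloc_valM ey ex.
rewrite -tofrac_eq0 in t0; rewrite -tofrac_eq0 in a0.
rewrite mulf_div [X in X / _]mulrC.
exact (@divff {fraction S} _ (frac_neq0 a0 t0)).
Qed.

End Stalk.

Lemma hfree_loc T X J J' : hfree T X J J' <->
  free_over (loc_ideal T X) (loc_ideal T J) (loc_ideal T J').
Proof.
split=> [[r [e [Je e_gen e_free]]]|[r [e [Je e_gen e_free]]]].
  have [g ge] := choice (fun i => hloc_exists (hfrac_full (Je i))).
  have combE (c : 'I_r -> hloc T) :
      hloc_val (\sum_i c i * g i) = \sum_i hloc_val (c i) * e i.
    by rewrite hloc_val_comb; apply: eq_bigr => i _; rewrite ge.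
  exists r, g; split=> [i|z Jz|c Jc i].
  - by rewrite /= /loc_mem ge.
  - have [c Tc Jc] := e_gen _ Jz.
    have [d dc] := choice (fun i => hloc_exists (Tc i)).
    exists d; rewrite /= /loc_mem hloc_valB combE.
    by under eq_bigr do rewrite dc.
  apply: (e_free (fun i => hloc_val (c i))) => [j|]; first exact: hloc_val_full.
  by rewrite -combE.
exists r, (fun i => hloc_val (e i)); split=> [//|z Jz|c Tc Jc i].
  have [y yz] := hloc_exists (hfrac_full Jz).
  have [|c Jc] := e_gen y; first by rewrite /= /loc_mem yz.
  exists (fun i => hloc_val (c i)) => [i|]; first exact: hloc_val_full.
  by rewrite -hloc_val_comb -yz -hloc_valB.
have [d dc] := choice (fun i => hloc_exists (Tc i)).
rewrite -dc; apply: e_free; rewrite /= /loc_mem hloc_val_comb.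
by under eq_bigr do rewrite dc.
Qed.

Lemma free_LsheafP T Z X J J' : sub_ideal Z X -> sub_ideal Z J' ->
  sub_ideal J' J -> (forall a b : S, X a -> J b -> J' (a * b)) ->
  free (Lsheaf Z X J J' T) <-> hfree T X J J'.
Proof.
move=> ZX ZJ' J'J XJ; rewrite hfree_loc.
by apply: free_LquotP; try exact: loc_ideal_sub; apply: loc_ideal_mul.
Qed.

Lemma base_change_id X :
  base_change (GRing.RMorphism.clone _ _ (@idfun k) _) X = X.
Proof.
apply: submodule_ext => f; split=> [|Xf]; last first.
  apply: span_incl; exists f => //; apply/mpolyP => mm.
  by rewrite mcoeff_map_mpoly.
apply=> _ [g Xg ->]; suff -> : map_mpoly idfun g = g by [].
by apply/mpolyP => mm; rewrite mcoeff_map_mpoly.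
Qed.

(** Geometric regularity applied to the identity extension of k. *)
Lemma smooth_regular X p : smooth X -> on_scheme X p ->
  regular_local_ring (OO (complement p) X).
Proof.
move=> X_smooth Xp.
have := X_smooth k (GRing.RMorphism.clone _ _ (@idfun k) _) p.
by rewrite base_change_id; apply.
Qed.

End HomogeneousLocalRings.

(** * Conclusion *)

Theorem proposition2p18 (k : fieldType) (n : nat)
    (Z X Y : ideal {mpoly k[n.+1]})
    (Z_closed : closed_subscheme Z) (X_closed : closed_subscheme X)
    (Y_closed : closed_subscheme Y)
    (Z_smooth : smooth Z) (Z_connected : connected Z)
    (X_smooth : smooth X) (X_connected : connected X)
    (X_sub_Y : subscheme X Y) (Y_sub_Z : subscheme Y Z)
    (X_regular : regular_embedding X Z)
    (Y_red : reduction Y X)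
    (m : nat) (m_length : S1_length Z X Y m)
    (F : nat -> ideal {mpoly k[n.+1]}) (F_S1 : S1_filtration Z X Y m F)
    (j : nat) (lt_jm : (j < m)%N) :
  (cohen_macaulay (F j) /\ locally_free_Lsheaf Z X (F j) (F j.+1) ->
   cohen_macaulay (F j.+1)) /\
  (cohen_macaulay (F j) /\ cohen_macaulay (F j.+1) ->
   locally_free_Lsheaf Z X (F j) (F j.+1)).
Proof.
have X_prime := S1_prime X_closed Y_sub_Z Y_red F_S1.
have FX := S1_sub X_closed Y_sub_Z Y_red F_S1 (ltnW lt_jm).
have F'F := S1_decreasing X_closed Y_sub_Z Y_red F_S1 lt_jm.
have XF := S1_mul X_closed Y_sub_Z Y_red F_S1 lt_jm.
have ZF' := S1_contains X_closed Y_sub_Z Y_red F_S1 lt_jm.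
have ZX f : Z f -> X f by move=> /ZF' /F'F /FX.
have [_ X_rad _] := S1_component X_closed Y_sub_Z Y_red F_S1 lt_jm.
have X_nil f : X f -> exists e, F j.+1 (f ^+ e) by move=> /X_rad.
have LP T := free_LsheafP T ZX ZF' F'F XF.
have stalk p (Xp : on_scheme X p) :
    (cohen_macaulay_ring (OO (complement p) (F j)) ->
     hfree (complement p) X (F j) (F j.+1) ->
     cohen_macaulay_ring (OO (complement p) (F j.+1))) /\
    (cohen_macaulay_ring (OO (complement p) (F j)) ->
     cohen_macaulay_ring (OO (complement p) (F j.+1)) ->
     hfree (complement p) X (F j) (F j.+1)).
  rewrite hfree_loc; have X_reg := smooth_regular X_smooth Xp.
  have Xp' := loc_ideal_sub (T := complement p) Xp.
  have FX' := loc_ideal_sub (T := complement p) FX.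
  have F'F' := loc_ideal_sub (T := complement p) F'F.
  have XF' := loc_ideal_mul (T := complement p) XF.
  have X_nil' := loc_ideal_nil (T := complement p) X_nil.
  split.
    exact (cohen_macaulay_extension (@noetherian_hloc k n _) (@loc_point_proper _ _ p)
      (@loc_point_local _ _ p) Xp' FX' F'F' XF' X_nil' X_reg).
  exact (free_cohen_macaulay (@noetherian_hloc k n _) (@loc_point_proper _ _ p)
    (@loc_point_local _ _ p) Xp' FX' F'F' XF' X_nil' X_reg).
split=> [[F_cm L_free] p F'p|[F_cm F'_cm] p Xp].
  (* Cohen-Macaulayness is to be shown at the points of Y_(j+1); they are points of X because X is
     nil modulo [F j.+1]. *)
  have Xp : on_scheme X p.
    move=> f /X_nil[e /F'p]; have [p1 pM] := point_prime p.
    by elim: e => [/p1//|e IH]; rewrite exprS => /pM[].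
  have [f pf /LP Lf] := L_free p Xp.
  apply: (stalk p Xp).1; last exact: hfree_localize pf Lf.
  by apply: F_cm => f' /FX /Xp.
have : hfree (complement p) X (F j) (F j.+1).
  apply: (stalk p Xp).2; first by apply: F_cm => f' /FX /Xp.
  by apply: F'_cm => f' /F'F /FX /Xp.
by move=> /(hfree_spread X_prime Xp)[f pf Lf]; exists f => //; apply/LP.
Qed.
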